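(* Let $d\ge1$ and let $(M_n,\mathcal F_n)_{n\ge0}$ be a martingale in $\mathbb R^d$ with $M_0=0$ and increments $X_n=M_n-M_{n-1}$ satisfying $\mathbb E[X_n\mid\mathcal F_{n-1}]=0$ and $\|X_n\|\le1$ a.s. for all $n\ge1$, where $\|\cdot\|$ is the Euclidean norm. Write $V_n=\sum_{i=1}^n\mathbb E[X_iX_i^{\top}\mid\mathcal F_{i-1}]$. Then, almost surely on the event \[ \Bigl\{\lambda_{\min}(V_n)\to\infty,\ \log\det\bigl(\lambda_{\min}(V_n)^{-1}V_n\bigr)=o\bigl(\lambda_{\min}(V_n)\bigr)\Bigr\}, \] one has \[ \limsup_{n\to\infty}\frac{\|V_n^{-1/2}M_n\|}{\sqrt{2\log\log\lambda_{\min}(V_n)+\log\det\bigl(\lambda_{\min}(V_n)^{-1}V_n\bigr)}}\le1. \]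
   Context: $\lambda_{\min}(A)$ denotes the smallest eigenvalue of a symmetric matrix $A$. On the stated event, $V_n$ is positive definite and $\lambda_{\min}(V_n)>e$ for all sufficiently large $n$, so the ratio in the limsup is defined for all sufficiently large $n$. *)

(* Defs.v *)
From HB Require Import structures.
From mathcomp Require Export all_boot all_order all_algebra.
From mathcomp Require Export all_classical all_reals all_analysis.

Set Implicit Arguments.
Unset Strict Implicit.
Unset Printing Implicit Defensive.

Export Order.TTheory GRing.Theory Num.Theory.
Export numFieldNormedType.Exports.

#[global] Open Scope classical_set_scope.
#[global] Open Scope ring_scope.

Section MatrixNotions.
Context {R : realType}.

(* The library norm `|x| on matrices is the sup norm. *)
Definition enorm (d : nat) (x : 'cV[R]_d) : R :=
  Num.sqrt (\sum_(i < d) x i ord0 ^+ 2).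

(* For A symmetric and 0 < d the set of eigenvalues is finite and nonempty,
   so that this infimum is the smallest eigenvalue of A. *)
Definition lambda_min (d : nat) (A : 'M[R]_d) : R :=
  inf [set a | eigenvalue A a].

Definition psdmx (d : nat) (A : 'M[R]_d) : Prop :=
  A^T = A /\ forall x : 'cV[R]_d, 0 <= (x^T *m A *m x) ord0 ord0.

(* The positive semidefinite square root, which exists and is unique when A is
   positive semidefinite; the value is 0 if there is no such root. *)
Definition sqrtmx (d : nat) (A : 'M[R]_d) : 'M[R]_d :=
  xget 0 [set S | psdmx S /\ S *m S = A].

Definition invsqrtmx (d : nat) (A : 'M[R]_d) : 'M[R]_d := invmx (sqrtmx A).

End MatrixNotions.

Section Martingales.
Context {R : realType} {disp : measure_display} {T : measurableType disp}.
Variable P : probability T R.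

Definition filtration (F : nat -> set (set T)) : Prop :=
  [/\ forall n, sigma_algebra setT (F n),
      forall n, F n `<=` measurable &
      forall n, F n `<=` F n.+1].

Definition measurable_wrt (G : set (set T)) (f : T -> R) : Prop :=
  forall B : set R, measurable B -> G (f @^-1` B).

(* Y is a version of E[X | G]. *)
Definition is_condexp (G : set (set T)) (X Y : T -> R) : Prop :=
  [/\ P.-integrable setT (EFin \o X),
      measurable_wrt G Y,
      P.-integrable setT (EFin \o Y) &
      forall A, G A ->
        (\int[P]_(w in A) (Y w)%:E = \int[P]_(w in A) (X w)%:E)%E].

Definition is_condexp_mx (G : set (set T)) (m n : nat)
    (X Y : T -> 'M[R]_(m, n)) : Prop :=
  forall i j, is_condexp G (fun w => X w i j) (fun w => Y w i j).

Definition martingale (d : nat) (F : nat -> set (set T))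
    (M : nat -> T -> 'cV[R]_d) : Prop :=
  [/\ filtration F,
      forall n i, measurable_wrt (F n) (fun w => M n w i ord0),
      forall n i, P.-integrable setT (EFin \o (fun w => M n w i ord0)) &
      forall n, is_condexp_mx (F n) (M n.+1) (M n)].

(* Only meaningful for 1 <= n. *)
Definition increment (d : nat) (M : nat -> T -> 'cV[R]_d) (n : nat) (w : T) :
    'cV[R]_d := M n w - M n.-1 w.

End Martingales.

(* Main.v *)
Require Import Defs.
From mathcomp Require Import ring lra zify measurable_realfun.

(** For a fixed vector theta with |theta| <= eps / (1 + eps), the process
    L_n(theta) = exp (<theta, M_n> - (1 + eps) / 2 * <theta, V_n theta>) is a
    nonnegative supermartingale, so by Ville's inequality it exceeds a level a
    with probability at most 1/a.  The usual mixture over theta (Robbins and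
    Siegmund) is replaced by a union bound over a countable grid: at scale
    2^-k, k >= 0, each coordinate of theta is an arbitrary dyadic multiple of
    2^-k, with weights summing to 1.  Almost surely, log L_n(theta) is then at
    most a constant minus the log-weight of theta, for all n and theta at once.

    Write lam = lambda_min V_n and choose k with 4^k <= lam < 4^(k+1).  The Schur
    decomposition of V_n yields a grid point within V_n-distance sqrt d of any
    prescribed vector, whose log-weight is of order
    - (log log lam + 1/2 log det (V_n / lam)): the pivots of V_n dictate how fine
    the grid has to be in each coordinate.  If |V_n^(-1/2) M_n| >= (1 + eta) D_n
    with D_n^2 = 2 log log lam + log det (V_n / lam), taking the vector of V_n-norm
    (1 + eta) D_n in the direction of V_n^-1 M_n gives a contradiction for n large;
    log det (V_n / lam) = o(lam) ensures that this vector is short. *)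

Set Implicit Arguments.
Unset Strict Implicit.
Unset Printing Implicit Defensive.

(** * Quadratic forms and the smallest eigenvalue *)

Section LinearAlgebra.
Context {R : realType}.
Implicit Types d : nat.

Definition bform d (A : 'M[R]_d) (x y : 'cV[R]_d) : R := (x^T *m A *m y) ord0 ord0.
Local Notation qform A x := (bform A x x).

Lemma bformDl d (A : 'M[R]_d) x y z : bform A (x + y) z = bform A x z + bform A y z.
Proof. by rewrite /bform linearD /= !mulmxDl mxE. Qed.

Lemma bformDr d (A : 'M[R]_d) x y z : bform A z (x + y) = bform A z x + bform A z y.
Proof. by rewrite /bform mulmxDr mxE. Qed.

Lemma bformZl d (A : 'M[R]_d) a x y : bform A (a *: x) y = a * bform A x y.
Proof. by rewrite /bform linearZ /= -!scalemxAl mxE. Qed.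

Lemma bformZr d (A : 'M[R]_d) a x y : bform A x (a *: y) = a * bform A x y.
Proof. by rewrite /bform -!scalemxAr mxE. Qed.

Lemma bformC d (A : 'M[R]_d) x y : A^T = A -> bform A x y = bform A y x.
Proof.
move=> sA; rewrite /bform -[in LHS](trmxK (x^T *m A *m y)) mxE.
by rewrite !trmx_mul trmxK sA mulmxA.
Qed.

Lemma bformDm d (A B : 'M[R]_d) x y : bform (A + B) x y = bform A x y + bform B x y.
Proof. by rewrite /bform mulmxDr mulmxDl mxE. Qed.

Lemma bformZm d (A : 'M[R]_d) a x y : bform (a *: A) x y = a * bform A x y.
Proof. by rewrite /bform -scalemxAr -scalemxAl mxE. Qed.

Lemma bformNm d (A : 'M[R]_d) x y : bform (- A) x y = - bform A x y.
Proof. by rewrite -scaleN1r bformZm mulN1r. Qed.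

Lemma bformE d (A : 'M[R]_d) x y :
  bform A x y = \sum_i \sum_j x i ord0 * A i j * y j ord0.
Proof.
rewrite /bform mxE exchange_big; apply: eq_bigr => j _.
by rewrite mxE mulr_suml; apply: eq_bigr => i _; rewrite mxE.
Qed.

Lemma bform_scalar d a (x y : 'cV[R]_d) :
  bform a%:M x y = a * \sum_i x i ord0 * y i ord0.
Proof.
rewrite /bform mul_mx_scalar -scalemxAl mxE; congr (_ * _).
by rewrite mxE; apply: eq_bigr => i _; rewrite mxE.
Qed.

Lemma sqr_enorm d (x : 'cV[R]_d) : enorm x ^+ 2 = \sum_i x i ord0 ^+ 2.
Proof. by rewrite sqr_sqrtr // sumr_ge0 // => i _; rewrite sqr_ge0. Qed.

Lemma enorm_ge0 d (x : 'cV[R]_d) : 0 <= enorm x.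
Proof. exact: sqrtr_ge0. Qed.

Lemma qform_scalar d a (x : 'cV[R]_d) : qform a%:M x = a * enorm x ^+ 2.
Proof. by rewrite bform_scalar sqr_enorm. Qed.

Lemma enorm_eq0 d (x : 'cV[R]_d) : enorm x = 0 -> x = 0.
Proof.
move=> x0; have := sqr_enorm x; rewrite x0 expr0n /= => /esym h.
apply/colP => i; rewrite mxE; apply/eqP; rewrite -sqrf_eq0; apply/eqP.
by apply: (psumr_eq0P _ h) => // j _; rewrite sqr_ge0.
Qed.

Lemma ler_coord_enorm d (x : 'cV[R]_d) i : `|x i ord0| <= enorm x.
Proof.
rewrite -ler_sqr ?nnegrE ?enorm_ge0 // sqr_enorm real_normK ?num_real //.
by rewrite (bigD1 i) //= lerDl sumr_ge0 // => j _; rewrite sqr_ge0.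
Qed.

Lemma psdmx_qform_ge0 d (A : 'M[R]_d) x : psdmx A -> 0 <= qform A x.
Proof. by case=> _; apply. Qed.

(** Nonnegativity at [s *: x + t *: y] with [s = qform A y] and [t = - bform A x y] yields
    [qform A y] times the claim. As [A] may be singular, [qform A y = 0] is a separate case. *)
Lemma psdmx_CauchySchwarz d (A : 'M[R]_d) x y : psdmx A ->
  bform A x y ^+ 2 <= qform A x * qform A y.
Proof.
move=> pA; have [sA _] := pA.
have h s t : 0 <= s ^+ 2 * qform A x + 2 * s * t * bform A x y + t ^+ 2 * qform A y.
  have := psdmx_qform_ge0 (s *: x + t *: y) pA.
  rewrite !(bformDl, bformDr) !(bformZl, bformZr) (bformC y x sA).
  by move/le_trans; apply; rewrite le_eqVlt; apply/orP; left; apply/eqP; ring.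
have [y0|y0] := eqVneq (qform A y) 0.
  have [->|b0] := eqVneq (bform A x y) 0; first by rewrite y0 mulr0 expr0n.
  (* If [bform A x y] were nonzero, this combination would have the value [- qform A x - 2 < 0]. *)
  have := h 1 (- (qform A x + 1) / bform A x y); have := psdmx_qform_ge0 x pA.
  rewrite y0 mulr0 mulr1 -mulrA divfK //; lra.
have yp : 0 < qform A y by rewrite lt_def y0 psdmx_qform_ge0.
have := h (qform A y) (- bform A x y).
set u := qform A y in yp *; set b := bform _ _ _; set v := qform A x => H.
rewrite -subr_ge0 -(pmulr_rge0 _ yp); apply: le_trans H _.
by rewrite le_eqVlt; apply/orP; left; apply/eqP; ring.
Qed.

Lemma enorm_CauchySchwarz d (x y : 'cV[R]_d) :
  `|\sum_i x i ord0 * y i ord0| <= enorm x * enorm y.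
Proof.
rewrite -ler_sqr ?nnegrE ?mulr_ge0 ?enorm_ge0 // real_normK ?num_real // exprMn.
have p1 : psdmx (1%:M : 'M[R]_d).
  by split=> [|z]; [rewrite trmx1|rewrite -/(bform _ _ _) qform_scalar mul1r sqr_ge0].
by have := psdmx_CauchySchwarz x y p1; rewrite !qform_scalar bform_scalar !mul1r.
Qed.

Lemma qform_bounded d (A : 'M[R]_d) :
  exists2 K, 0 < K & forall x, `|qform A x| <= K * enorm x ^+ 2.
Proof.
(* The summand 1 keeps the bound positive even for [A = 0]; it gets inverted in
   [psdmx_unit_coercive]. *)
exists (1 + \sum_i \sum_j `|A i j|) => [|x].
  by rewrite ltr_pwDl // sumr_ge0 // => i _; rewrite sumr_ge0.
rewrite bformE mulrDl mul1r (le_trans (ler_norm_sum _ _ _)) //.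
apply: ler_wpDl; first exact: sqr_ge0.
rewrite mulr_suml ler_sum // => i _; rewrite (le_trans (ler_norm_sum _ _ _)) //.
rewrite mulr_suml ler_sum // => j _; rewrite !normrM mulrAC mulrC expr2.
by rewrite ler_wpM2l // ler_pM // ler_coord_enorm.
Qed.

(* |x|^4 = (x^T A (A^-1 x))^2 <= (x^T A x) (x^T A^-1 x) and the last factor is O(|x|^2). *)
Lemma psdmx_unit_coercive d (A : 'M[R]_d) : psdmx A -> A \in unitmx ->
  exists2 c, 0 < c & psdmx (A - c%:M).
Proof.
move=> pA uA; have [sA _] := pA; have [K K0 hK] := qform_bounded (invmx A).
exists K^-1; first by rewrite invr_gt0.
split; first by rewrite linearB /= sA tr_scalar_mx.
move=> x; rewrite -/(bform _ x x) bformDm bformNm qform_scalar subr_ge0.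
have := psdmx_CauchySchwarz x (invmx A *m x) pA.
rewrite (_ : bform A x (invmx A *m x) = enorm x ^+ 2); last first.
  rewrite /bform -mulmxA mulKVmx // -[x^T]mulmx1 -/(bform 1%:M x x).
  by rewrite qform_scalar mul1r.
rewrite (_ : qform A (invmx A *m x) = qform (invmx A) x); last first.
  by rewrite /bform trmx_mul trmx_inv sA -!mulmxA mulKVmx // .
have := hK x; have := psdmx_qform_ge0 x pA.
set q := qform A x; set e := enorm x ^+ 2 => q0 h1 h2.
have e0 : 0 <= e by rewrite sqr_ge0.
rewrite -ler_pdivlMl ?invr_gt0 // invrK.
have [->|en] := eqVneq e 0; first by rewrite mulr_ge0 // ltW.
have ep : 0 < e by rewrite lt_def en.
rewrite -(ler_pM2r ep); rewrite -expr2 (le_trans h2) //.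
rewrite [K * q]mulrC -mulrA ler_wpM2l //; exact: le_trans (ler_norm _) h1.
Qed.

(** Let [mu] be the largest [a] with [A - a%:M] positive semidefinite. If [A - mu%:M] were
    invertible, it would be coercive and [mu] could be raised; so [mu] is an eigenvalue. Testing the
    form on eigenvectors shows that no eigenvalue is smaller. *)
Lemma psdmx_sub_lambda_min d (A : 'M[R]_d) : (1 <= d)%N -> A^T = A ->
  psdmx (A - (lambda_min A)%:M).
Proof.
move=> d1 sA; pose S := [set a : R | psdmx (A - a%:M)].
have symA a : (A - a%:M)^T = A - a%:M by rewrite linearB /= sA tr_scalar_mx.
have SE a : S a <-> forall x, a * enorm x ^+ 2 <= qform A x.
  split=> [pa x|h].
    have := psdmx_qform_ge0 x pa.
    by rewrite bformDm bformNm qform_scalar subr_ge0.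
  split=> // x; rewrite -/(bform _ x x) bformDm bformNm qform_scalar subr_ge0.
  exact: h.
have [K K0 hK] := qform_bounded A.
pose e : 'cV[R]_d := const_mx 1.
have e0 : 0 < enorm e ^+ 2.
  rewrite lt_def sqr_ge0 andbT; apply/eqP => /eqP; rewrite sqrf_eq0 => /eqP/enorm_eq0.
  by move/colP/(_ (Ordinal d1)); rewrite !mxE => /eqP; rewrite oner_eq0.
have S0 : S (- K).
  apply/SE => x; rewrite mulNr -[leRHS]opprK lerN2.
  by rewrite (le_trans _ (hK x)) // -normrN ler_norm.
have Sub : has_ubound S.
  exists K => a /SE/(_ e) h; rewrite -(ler_pM2r e0) (le_trans h) //.
  exact: le_trans (ler_norm _) (hK e).
have hS : has_sup S by split => //; exists (- K).
pose mu := sup S.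
have Smu : S mu.
  apply/SE => x; apply/ler_addgt0Pr => eps eps0.
  have eps1 : 0 < eps / (1 + enorm x ^+ 2) by rewrite divr_gt0 // ltr_pwDl // sqr_ge0.
  have [a Sa amu] := sup_adherent eps1 hS.
  have /SE/(_ x) := Sa; rewrite -/mu in amu.
  set q := qform A x => h; move: amu; rewrite ltrBlDr => amu.
  have x0 : 0 <= enorm x ^+ 2 by rewrite sqr_ge0.
  rewrite (le_trans (ler_wpM2r x0 (ltW amu))) // mulrDl lerD //.
  rewrite mulrAC ler_pdivrMr ?ltr_pwDl // ler_wpM2l ?ltW //; lra.
have evmu : eigenvalue A mu.
  rewrite /eigenvalue /eigenspace; apply/negP => /eqP ker0.
  have uA : A - mu%:M \in unitmx by rewrite -row_free_unit -kermx_eq0 ker0.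
  have [c c0 pc] := psdmx_unit_coercive Smu uA.
  have : S (mu + c) by rewrite /S /= raddfD opprD addrA.
  by move/(ub_le_sup Sub); rewrite -/mu; lra.
have evge a : eigenvalue A a -> mu <= a.
  (* Eigenvectors are row vectors here, hence the transposes. *)
  move=> /eigenvalueP [v va vn0]; have /SE/(_ v^T) := Smu.
  have := qform_scalar a v^T; rewrite /bform trmxK mul_mx_scalar -va => ->.
  rewrite ler_pM2r // lt_def sqr_ge0 andbT; apply: contra_neq vn0 => /eqP.
  rewrite sqrf_eq0 => /eqP/enorm_eq0 vt; by rewrite -[v]trmxK vt trmx0.
suff -> : lambda_min A = mu by [].
apply/eqP; rewrite eq_le; apply/andP; split.
  by apply: ge_inf => //; exists mu => a /evge.
by apply: lb_le_inf => [|a /evge //]; exists mu.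
Qed.

Lemma psdmx_subP d (A : 'M[R]_d) lam : A^T = A ->
  psdmx (A - lam%:M) <-> forall x, lam * enorm x ^+ 2 <= qform A x.
Proof.
move=> sA; split=> [pA x|h].
  by have := psdmx_qform_ge0 x pA; rewrite bformDm bformNm qform_scalar subr_ge0.
split=> [|x]; first by rewrite linearB /= sA tr_scalar_mx.
by rewrite -/(bform _ x x) bformDm bformNm qform_scalar subr_ge0.
Qed.

Lemma psdmx_sub_sym d (A : 'M[R]_d) lam : psdmx (A - lam%:M) -> A^T = A.
Proof. by move=> [+ _]; rewrite linearB /= tr_scalar_mx => /addIr. Qed.

(** Completing the square in the first coordinate: [a] is the pivot and [r] the rest of the first
    row. Choosing [t] to annihilate the square shows that [S] inherits the lower bound [lam]. *)
Lemma schur_complement d (A : 'M[R]_(1 + d)) lam : 0 < lam -> psdmx (A - lam%:M) ->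
  exists a (r : 'rV[R]_d) S,
  [/\ lam <= a, psdmx (S - lam%:M), \det A = a * \det S &
      forall t (y : 'cV[R]_d), qform A (col_mx t%:M y) =
        a * (t + a^-1 * (r *m y) ord0 ord0) ^+ 2 + qform S y].
Proof.
move=> lam0 pA; have sA := psdmx_sub_sym pA; have /(psdmx_subP _ sA) lA := pA.
pose a := A ord0 ord0; pose r := ursubmx A.
pose S := drsubmx A - a^-1 *: (r^T *m r); exists a, r, S.
have ulE : ulsubmx A = a%:M.
  by rewrite [LHS]mx11_scalar !mxE /a; congr (A _ _)%:M; apply/val_inj.
have dlE : dlsubmx A = r^T by rewrite /r trmx_ursub sA.
have AE : A = block_mx a%:M r r^T (drsubmx A) by rewrite -ulE -dlE /r submxK.
have ecol t (y : 'cV[R]_d) : enorm (col_mx t%:M y) ^+ 2 = t ^+ 2 + enorm y ^+ 2.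
  rewrite !sqr_enorm big_split_ord big_ord1 /= col_mxEu mxE eqxx mulr1n.
  by congr (_ + _); apply: eq_bigr => i _; rewrite col_mxEd.
have qA0 t (y : 'cV[R]_d) : qform A (col_mx t%:M y) =
    a * t ^+ 2 + 2 * t * (r *m y) ord0 ord0 + qform (drsubmx A) y.
  rewrite {1}AE /bform tr_col_mx mul_row_block mul_row_col tr_scalar_mx.
  rewrite -!scalar_mxM mulmxDl !mul_mx_scalar !mul_scalar_mx.
  rewrite mulmxDl -scalemxAl -trmx_mul.
  set m := r *m y; set q := y^T *m _ *m y; rewrite !mxE eqxx !mulr1n; ring.
have la : lam <= a.
  have := lA (col_mx 1%:M 0); rewrite ecol qA0 mulmx0 mxE /bform mulmx0 mxE.
  rewrite expr1n !mulr0 !addr0 mulr1 => h.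
  by apply: le_trans h; rewrite ler_peMr ?lerDl ?sqr_ge0 // (ltW lam0).
have a0 : a != 0 by rewrite gt_eqF // (lt_le_trans lam0).
have rr (y : 'cV[R]_d) : qform (r^T *m r) y = (r *m y) ord0 ord0 ^+ 2.
  rewrite /bform mulmxA -trmx_mul -mulmxA mxE big_ord1 mxE expr2.
  by rewrite (ord1 ord0).
have qA t (y : 'cV[R]_d) : qform A (col_mx t%:M y) =
        a * (t + a^-1 * (r *m y) ord0 ord0) ^+ 2 + qform S y.
  rewrite qA0 /S bformDm bformNm bformZm rr; field; exact: a0.
have sS : S^T = S.
  by rewrite /S linearB /= linearZ /= trmx_mul trmxK trmx_drsub sA.
split => //.
  apply/(psdmx_subP _ sS) => y; pose t := - (a^-1 * (r *m y) ord0 ord0).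
  have := lA (col_mx t%:M y); rewrite qA /t addNr expr0n mulr0 add0r => h; apply: le_trans h.
  by rewrite ecol ler_wpM2l ?(ltW lam0) // lerDr sqr_ge0.
(* Block LU factorization, for the determinant. *)
have -> : A = block_mx 1%:M 0 (a^-1 *: r^T) 1%:M *m block_mx a%:M r 0 S.
  rewrite mulmx_block !mul1mx !mul0mx ?mulmx0 !addr0 {1}AE /S.
  by rewrite mul_mx_scalar scalerA mulfV // scale1r -scalemxAl addrC subrK.
by rewrite det_mulmx det_lblock det_ublock !det1 !mul1r det_scalar1.
Qed.

(** The determinant is the product of the pivots, each of which is at least [lam]. *)
Lemma det_ge d (A : 'M[R]_d) lam : 0 < lam -> psdmx (A - lam%:M) -> lam ^+ d <= \det A.
Proof.
move=> lam0; elim: d A => [|d IH] A pA; first by rewrite det_mx00.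
have [a [r [S [la pS -> _]]]] := @schur_complement d A _ lam0 pA.
rewrite exprS; apply: ler_pM => //; last exact: IH.
  exact: ltW.
by rewrite exprn_ge0 // ltW.
Qed.

(** A code [(j, z, b)] stands for the number [(-1)^b z r / 2^j]. Weights will be put on codes, so it
    is harmless that several codes name the same number. *)
Definition dyadic (r : R) (g : nat * nat * bool) : R :=
  r / 2 ^+ g.1.1 * ((-1) ^+ g.2 * g.1.2%:R).

(** Take the least [j] for which the mesh [r / 2 ^+ j] is at most [a^(-1/2)]. By minimality,
    [4 ^+ j] exceeds [r ^+ 2 * a] by a factor of at most 4; for [j = 0] this uses
    [1 <= r ^+ 2 * a]. *)
Lemma dyadic_approx (r a x : R) : 0 < r -> 1 <= r ^+ 2 * a ->
  exists g, a * (dyadic r g - x) ^+ 2 <= 1 /\ (2 ^+ g.1.1) ^+ 2 <= 4 * (r ^+ 2 * a).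
Proof.
move=> r0 ra1; have a0 : 0 < a.
  by rewrite -(pmulr_rgt0 _ (exprn_gt0 2 r0)) (lt_le_trans ltr01).
have exj : exists j : nat, r ^+ 2 * a <= 4 ^+ j.
  exists (Num.bound (r ^+ 2 * a)).
  rewrite (le_trans (ltW (archi_boundP (le_trans ler01 ra1)))) //.
  by rewrite -natrX ler_nat ltnW // ltn_expl.
have [j hj jmin] := ex_minnP exj.
have p4 n : (2 ^+ n : R) ^+ 2 = 4 ^+ n by rewrite exprAC expr2 -natrM.
(* [y] is [x] in units of the mesh; it is rounded towards zero, with error less than 1. *)
pose y := x * 2 ^+ j / r; pose z := Num.truncn `|y|.
exists (j, z, y < 0); rewrite /dyadic /=; split; last first.
  rewrite p4; case: j jmin {hj y z} => [_|j jmin]; first by rewrite expr0; lra.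
  by rewrite exprS ler_pM2l // ltW // ltNge; apply/negP => /jmin; rewrite ltnn.
have -> : r / 2 ^+ j * ((-1) ^+ (y < 0)%R * z%:R) - x =
    r / 2 ^+ j * ((-1) ^+ (y < 0)%R * (z%:R - `|y|)).
  rewrite [in RHS]mulrBr -realEsign ?num_real // [RHS]mulrBr /y; congr (_ - _).
  by field; rewrite expf_eq0 pnatr_eq0 andbF gt_eqF.
rewrite !exprMn -exprM mulnC exprM sqrrN expr1n expr1n mul1r exprVn p4.
have -> : a * (r ^+ 2 / 4 ^+ j * (z%:R - `|y|) ^+ 2) =
   (r ^+ 2 * a) / 4 ^+ j * (z%:R - `|y|) ^+ 2 by ring.
have j0 : (0 : R) < 4 ^+ j by rewrite exprn_gt0.
rewrite -[leRHS]mulr1 ler_pM ?sqr_ge0 //.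
- by rewrite divr_ge0 ?(le_trans ler01 ra1) ?ltW.
- by rewrite ler_pdivrMr // mul1r.
- have /andP[h1 h2] := truncn_itv (normr_ge0 y); rewrite -/z -natr1 in h1 h2.
  rewrite -sqrrN opprB expr_le1 // ; lra.
Qed.

Definition gridpt d (r : R) (g : 'I_d -> nat * nat * bool) : 'cV[R]_d :=
  \col_i dyadic r (g i).

(* Induction along Schur complements: each coordinate is rounded at the precision
   dictated by its pivot, and the product of the pivots is [\det A]. *)
Lemma grid_approx d (A : 'M[R]_d) lam r : 0 < lam -> psdmx (A - lam%:M) ->
  0 < r -> 1 <= r ^+ 2 * lam -> forall x : 'cV[R]_d, exists g,
    qform A (gridpt r g - x) <= d%:R /\
    (\prod_i 2 ^+ (g i).1.1) ^+ 2 <= (4 * r ^+ 2) ^+ d * \det A.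
Proof.
move=> lam0 pA r0 rlam; elim: d A pA => [|d IH] A pA x.
  exists (fun=> (0%N, 0%N, false)).
  by rewrite big_ord0 expr1n det_mx00 expr0 mulr1 bformE big_ord0.
have [a [b [S [la pS dA qA]]]] := @schur_complement d A lam lam0 pA.
pose x1 := (x : 'cV_(1 + d)) ord0 ord0; pose x2 := dsubmx (x : 'cV_(1 + d)).
have xE : x = col_mx x1%:M x2.
  have -> : x1%:M = usubmx (x : 'cV_(1 + d)); last by rewrite /x2 vsubmxK.
  by rewrite [RHS]mx11_scalar !mxE /x1; congr (x _ _)%:M; apply/val_inj.
have [g [hg pg]] := IH S pS x2.
have ra : 1 <= r ^+ 2 * a by rewrite (le_trans rlam) // ler_wpM2l // sqr_ge0.
(* The target is shifted by the coupling with the coordinates already rounded, so that the completed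
   square is exactly the rounding error of the first coordinate. *)
have [h [hh ph]] := dyadic_approx
  (x1 - a^-1 * (b *m (gridpt r g - x2)) ord0 ord0) r0 ra.
pose G (i : 'I_(1 + d)) := match fintype.split i with inl _ => h | inr k => g k end.
have Gl i : G (lshift d i) = h by rewrite /G (unsplitK (inl i)).
have Gr i : G (rshift 1 i) = g i by rewrite /G (unsplitK (inr i)).
exists G; split; last first.
  rewrite (@big_split_ord _ _ _ 1 d) big_ord1 /= Gl.
  rewrite (eq_bigr (fun i => 2 ^+ (g i).1.1)); last by move=> i _; rewrite Gr.
  rewrite dA exprMn (exprS _ d).
  have -> u v : 4 * r ^+ 2 * u * (a * v) = 4 * (r ^+ 2 * a) * (u * v) by ring.
  by rewrite ler_pM // sqr_ge0.
have -> : gridpt r G - x = col_mx (dyadic r h - x1)%:M (gridpt r g - x2).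
  rewrite xE; apply/colP => i; rewrite -(splitK i).
  case: (fintype.split i) => k /=.
    rewrite [LHS]mxE [(- col_mx _ _ : matrix _ _ _) _ _]mxE !col_mxEu [gridpt _ _ _ _]mxE Gl.
    by rewrite ord1 !mxE eqxx !mulr1n.
  rewrite [LHS]mxE [(- col_mx _ _ : matrix _ _ _) _ _]mxE !col_mxEd [gridpt _ _ _ _]mxE Gr.
  by rewrite !mxE.
rewrite qA -natr1 addrC lerD //; apply: le_trans hh.
rewrite le_eqVlt; apply/orP; left; apply/eqP; ring.
Qed.

End LinearAlgebra.

(** * Conditional expectations and nonnegative supermartingales *)

Section SubSigmaAlgebra.
Context {R : realType} {disp : measure_display} {T : measurableType disp}.
Variable P : probability T R.
Implicit Types (G : set (set T)) (f g : T -> R).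

Import HBNNSimple.
(** Generating a sigma-algebra from [G] adds nothing to it; this makes the general facts on
    measurable functions available for [G]. *)
Lemma measurable_wrtP G f : sigma_algebra setT G ->
  measurable_wrt G f <-> measurable_fun setT (f : g_sigma_algebraType G -> R).
Proof.
move=> sG; split=> [mf _ B mB|mf B mB].
  rewrite setTI; apply: sub_sigma_algebra; exact: mf.
by have := mf measurableT B mB; rewrite setTI /measurable /= sigma_algebra_id.
Qed.

Lemma sub_sigma_algebraE G A : sigma_algebra setT G ->
  measurable (A : set (g_sigma_algebraType G)) -> G A.
Proof. by move=> sG; rewrite /measurable /= sigma_algebra_id. Qed.

Lemma measurable_wrt_le G f : G `<=` measurable -> measurable_wrt G f ->
  measurable_fun setT f.
Proof. by move=> sG mf _ B mB; rewrite setTI; apply: sG; exact: mf. Qed.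

Lemma measurable_wrt_mono G H f : G `<=` H -> measurable_wrt G f -> measurable_wrt H f.
Proof. by move=> GH mf B mB; apply: GH; exact: mf. Qed.

Lemma measurable_wrt_cst G (c : R) : sigma_algebra setT G -> measurable_wrt G (fun=> c).
Proof. by move=> sG; apply/measurable_wrtP => //; exact: measurable_cst. Qed.

Lemma measurable_wrtD G f g : sigma_algebra setT G ->
  measurable_wrt G f -> measurable_wrt G g -> measurable_wrt G (f \+ g).
Proof.
move=> sG /(measurable_wrtP _ sG) mf /(measurable_wrtP _ sG) mg.
by apply/measurable_wrtP => //; exact: measurable_funD.
Qed.

Lemma measurable_wrtM G f g : sigma_algebra setT G ->
  measurable_wrt G f -> measurable_wrt G g -> measurable_wrt G (f \* g).
Proof.
move=> sG /(measurable_wrtP _ sG) mf /(measurable_wrtP _ sG) mg.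
by apply/measurable_wrtP => //; exact: measurable_funM.
Qed.

Lemma measurable_wrt_sum G (I : Type) (s : seq I) (h : I -> T -> R) : sigma_algebra setT G ->
  (forall i, measurable_wrt G (h i)) -> measurable_wrt G (fun w => \sum_(i <- s) h i w).
Proof.
move=> sG mh; apply/measurable_wrtP => //.
by apply: measurable_sum => i; apply/measurable_wrtP.
Qed.

Lemma measurable_wrt_comp G f (h : R -> R) : measurable_fun setT h ->
  measurable_wrt G f -> measurable_wrt G (h \o f).
Proof.
move=> mh mf B mB; rewrite comp_preimage; apply: mf.
by have := mh measurableT B mB; rewrite setTI.
Qed.

(* Monotone class: first [Z] simple, then monotone limits of simple functions. *)
Lemma ge0_le_integral_mul G (f h Z : T -> R) :
  sigma_algebra setT G -> G `<=` measurable ->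
  (forall w, 0 <= f w) -> (forall w, 0 <= h w) ->
  measurable_fun setT f -> measurable_fun setT h ->
  (forall B, G B -> (\int[P]_(w in B) (f w)%:E <= \int[P]_(w in B) (h w)%:E)%E) ->
  (forall w, 0 <= Z w) -> measurable_wrt G Z ->
  (\int[P]_w (Z w * f w)%:E <= \int[P]_w (Z w * h w)%:E)%E.
Proof.
move=> sG Gm f0 h0 mf mh fh Z0 mZ.
have mZ' : measurable_fun setT (EFin \o Z : g_sigma_algebraType G -> \bar R).
  by apply/measurable_EFinP; apply/measurable_wrtP.
(* The approximation is carried out on [g_sigma_algebraType G], so that the level sets belong to [G]
   and the hypothesis applies to them. *)
pose s := nnsfun_approx measurableT mZ'.
pose u n (w : T) : R := s n w.
have Gu n y : G (u n @^-1` [set y]).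
  by apply: sub_sigma_algebraE => //; exact: (measurable_funPTI (s n)).
have mu n : measurable_fun setT (u n).
  by apply: (measurable_wrt_le Gm); apply/measurable_wrtP.
have u0 n w : 0 <= u n w by exact: fun_ge0.
have mono (g : T -> R) : (forall w, 0 <= g w) -> measurable_fun setT g ->
    (\int[P]_w (u n w * g w)%:E)%E @[n --> \oo] --> (\int[P]_w (Z w * g w)%:E)%E.
  move=> g0 mg.
  have -> : (\int[P]_w (Z w * g w)%:E =
             \int[P]_w (limn (fun n => (u n w * g w)%:E)))%E.
    apply: eq_integral => w _; apply/esym/cvg_lim => //.
    under eq_fun do rewrite EFinM.
    rewrite EFinM; apply: cvgeZr => //.
    by apply: (cvg_nnsfun_approx measurableT mZ') => // t _; rewrite lee_fin.
  apply: cvg_monotone_convergence => //.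
  - move=> n; apply/measurable_EFinP; exact: measurable_funM.
  - by move=> n w _; rewrite lee_fin mulr_ge0.
  - move=> w _ m n mn; rewrite lee_fin ler_wpM2r //.
    by have /lefP := nd_nnsfun_approx measurableT mZ' mn; exact.
rewrite -(cvg_lim _ (mono f f0 mf)) // -(cvg_lim _ (mono h h0 mh)) //.
apply: lee_lim; [by apply/cvg_ex; eexists; exact: mono..|].
apply: nearW => n.
have simple (g : T -> R) : (forall w, 0 <= g w) -> measurable_fun setT g ->
    (\int[P]_w (u n w * g w)%:E =
     \sum_(y \in range (u n)) (y%:E * \int[P]_(w in u n @^-1` [set y]) (g w)%:E))%E.
  move=> g0 mg.
  have fin : finite_set (range (u n)) by exact: (fimfunP (s n)).
  transitivity (\int[P]_w \sum_(y \in range (u n))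
     (y * (\1_(u n @^-1` [set y]) w * g w))%:E)%E.
    apply: eq_integral => w _; rewrite fsumEFin //; congr (_%:E).
    rewrite /u (fimfunE (s n)) mulrC mulr_fsumr //.
    by apply: eq_fsbigr => y _; ring.
  rewrite ge0_integral_fsum //; last 2 first.
  - move=> y; apply/measurable_EFinP; apply: measurable_funM => //.
    by apply: measurable_funM => //; apply: measurable_indic; apply: Gm.
  (* [y] ranges over all reals here; a negative one has an empty level set because [u n] is
     nonnegative. *)
  - move=> y w _; rewrite lee_fin mulrA mulr_ge0 // indicE.
    by case: (boolP (w \in _)) => [/set_mem <-|]; rewrite ?mulr1 ?mulr0.
  apply: eq_fsbigr => y /set_mem [w0 _ yE].
  under eq_integral do rewrite EFinM.
  rewrite ge0_integralZl //; last first.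
  - by rewrite lee_fin -yE.
  - by move=> w _; rewrite lee_fin mulr_ge0.
  - apply/measurable_EFinP; apply: measurable_funM => //.
    by apply: measurable_indic; apply: Gm.
  rewrite [in RHS]integral_mkcond epatch_indic; congr (_ * _)%E.
  by apply: eq_integral => w _; rewrite muleC.
rewrite !simple //; apply: lee_fsum => [|y [w _ <-]]; first exact: (fimfunP (s n)).
by rewrite lee_wpmul2l ?lee_fin // fh.
Qed.

(** Used once for the linear form of the increment along theta and, nested, for its square. *)
Lemma is_condexp_sum G (I : Type) (s : seq I) (a : I -> R) (X Y : I -> T -> R) :
  sigma_algebra setT G -> G `<=` measurable ->
  (forall i, is_condexp P G (X i) (Y i)) ->
  is_condexp P G (fun w => \sum_(i <- s) a i * X i w) (fun w => \sum_(i <- s) a i * Y i w).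
Proof.
move=> sG Gm XY.
have intS (Z : I -> T -> R) : (forall i, P.-integrable setT (EFin \o Z i)) ->
    P.-integrable setT (EFin \o (fun w => \sum_(i <- s) a i * Z i w)).
  move=> iZ; have := @integrable_sum _ _ _ P _ measurableT I s xpredT
    (fun i w => (a i)%:E * (Z i w)%:E)%E.
  rewrite (_ : (fun w => _) = (EFin \o (fun w => \sum_(i <- s) a i * Z i w))); last first.
    by apply/funext => w /=; rewrite -sumEFin; apply: eq_bigr => i _; rewrite EFinM.
  by apply=> i _; apply: integrableZl => //; exact: iZ.
have intA (Z : I -> T -> R) A : measurable A ->
    (forall i, P.-integrable setT (EFin \o Z i)) ->
    (\int[P]_(w in A) (\sum_(i <- s) a i * Z i w)%:E =
     \sum_(i <- s) (a i)%:E * \int[P]_(w in A) (Z i w)%:E)%E.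
  move=> mA iZ.
  have iA i : P.-integrable A (EFin \o Z i).
    exact: integrableS measurableT mA (@subsetT _ _) (iZ i).
  transitivity (\int[P]_(w in A) \sum_(i <- s) ((a i)%:E * (Z i w)%:E))%E.
    by apply: eq_integral => w _; rewrite -sumEFin; apply: eq_bigr => i _; rewrite EFinM.
  rewrite integral_sum //; first by apply: eq_bigr => i _; rewrite integralZl //; exact: iA.
  by move=> i; apply: integrableZl => //; exact: iA.
split.
- by apply: intS => i; case: (XY i).
- apply: measurable_wrt_sum => // i; apply: measurable_wrtM => //.
    exact: measurable_wrt_cst.
  by case: (XY i).
- by apply: intS => i; case: (XY i).
- move=> A GA; rewrite !intA //; try (by move=> i; case: (XY i)); try exact: Gm.
  by apply: eq_bigr => i _; case: (XY i) => _ _ _ ->.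
Qed.

(** Conditionally on [G], [expR X] has mean at most [1 + c q <= expR (c q)]. This is shown for
    integrals over sets of [G], and [ge0_le_integral_mul] then inserts the factor [Z]. *)
Lemma expR_condexp_le G (X q Z : T -> R) (c delta : R) :
  sigma_algebra setT G -> G `<=` measurable ->
  is_condexp P G X (fun=> 0) -> is_condexp P G (fun w => X w ^+ 2) q ->
  {ae P, forall w, `|X w| <= delta} ->
  (forall y, `|y| <= delta -> expR y <= 1 + y + c * y ^+ 2) -> 1 <= 4 * c ->
  (forall w, 0 <= Z w) -> measurable_wrt G Z ->
  (\int[P]_w (Z w * expR (X w))%:E <= \int[P]_w (Z w * expR (c * q w))%:E)%E.
Proof.
move=> sG Gm [iX _ _ X0] [iX2 mq iq Xq] Xd hexp c4.
have mX : measurable_fun setT X by apply/measurable_EFinP; exact: measurable_int iX.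
have mq' := measurable_wrt_le Gm mq.
have mexp (f : T -> R) : measurable_fun setT f -> measurable_fun setT (expR \o f).
  by move=> mf; exact: measurableT_comp.
have mcq : measurable_fun setT (fun w => c * q w) by exact: measurable_funM.
apply: ge0_le_integral_mul => //; try (by move=> w; exact: expR_ge0).
- exact: mexp.
- exact: (mexp (fun w => c * q w)).
move=> B /[dup] GB /Gm mB.
have iXB : P.-integrable B (EFin \o X) by exact: integrableS measurableT mB _ iX.
have iX2B : P.-integrable B (EFin \o (fun w => X w ^+ 2)).
  exact: integrableS measurableT mB _ iX2.
have iqB : P.-integrable B (EFin \o q) by exact: integrableS measurableT mB _ iq.
have i1B : P.-integrable B (fun=> 1%:E).
  exact: (finite_measure_integrable_cst P 1).
(* By [1 <= 4 * c] the quadratic is nonnegative on the whole line, hence also on the null set where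
   [X] exceeds [delta]. *)
have U0 y : 0 <= 1 + y + c * y ^+ 2.
  have -> : 1 + y + c * y ^+ 2 = (1 + y / 2) ^+ 2 + (c - 1 / 4) * y ^+ 2 by field.
  by rewrite addr_ge0 ?sqr_ge0 // mulr_ge0 ?sqr_ge0 // subr_ge0 ler_pdivrMr // mulrC.
apply: (@le_trans _ _ (\int[P]_(w in B) (1 + X w + c * X w ^+ 2)%:E)%E).
  apply: ae_ge0_le_integral => //.
  - by apply/measurable_EFinP; apply: measurable_funTS; exact: mexp.
  - by move=> w _; rewrite lee_fin.
  - apply/measurable_EFinP; apply: measurable_funTS; apply: measurable_funD => //.
      exact: measurable_funD.
    by apply: measurable_funM => //; exact: measurable_funX.
  - by apply: filterS Xd => w Xw _; rewrite lee_fin hexp.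
have -> : (\int[P]_(w in B) (1 + X w + c * X w ^+ 2)%:E =
           \int[P]_(w in B) (1 + c * q w)%:E)%E.
  under eq_integral do rewrite !EFinD.
  rewrite integralD //; last 2 first.
  - by apply: integrableD.
  - by under eq_fun do rewrite EFinM; exact: integrableZl.
  rewrite integralD //.
  under [RHS]eq_integral do rewrite EFinD.
  rewrite integralD //; last first.
    by under eq_fun do rewrite EFinM; exact: integrableZl.
  have cint (f : T -> R) : P.-integrable B (EFin \o f) ->
      (\int[P]_(w in B) (c * f w)%:E = c%:E * \int[P]_(w in B) (f w)%:E)%E.
    by move=> fi; under eq_integral do rewrite EFinM; exact: integralZl.
  rewrite (cint q iqB) (cint (fun w => X w ^+ 2) iX2B).
  by rewrite -X0 // integral0 adde0 Xq.
(* The version [q] is not known to be nonnegative, so [1 + c * q] is replaced by its positive part,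
   which the exponential still dominates. *)
pose f w := (1 + c * q w)%:E; rewrite -/(f _) integralE.
apply: (@le_trans _ _ (\int[P]_(w in B) f^\+ w)%E).
  by rewrite -[leRHS]adde0 leeD // oppe_le0 integral_ge0.
apply: ge0_le_integral => //.
- apply: measurable_funepos; apply/measurable_EFinP; apply: measurable_funTS.
  exact: measurable_funD.
- by apply/measurable_EFinP; apply: measurable_funTS; exact: (mexp (fun w => c * q w)).
- move=> w _; rewrite funeposE /f -EFin_max lee_fin ge_max expR_ge0 andbT.
  exact: expR_ge1Dx.
Qed.

(** With [N n] the event that the level [a] is not reached up to time [n], the quantity
    [a P(~N n) + \int_(N n) L n] stays at most 1. This replaces stopping at the first passage. *)
Lemma ville_inequality (F : nat -> set (set T)) (L : nat -> T -> R) (a : R) :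
  filtration F -> (forall n, measurable_wrt (F n) (L n)) -> (forall n w, 0 <= L n w) ->
  (forall n A, F n A ->
     (\int[P]_(w in A) (L n.+1 w)%:E <= \int[P]_(w in A) (L n w)%:E)%E) ->
  (\int[P]_w (L 0%N w)%:E <= 1)%E -> 0 < a ->
  (P (\bigcup_n [set w | (a <= L n w)%R]) <= (a^-1)%:E)%E.
Proof.
move=> [sF Fm Fi] mL L0 Ls L1 a0.
pose N n := [set w | forall k, (k <= n)%N -> L k w < a].
pose U n := [set w | a <= L n w].
have FU n : F n (U n).
  rewrite (_ : U n = L n @^-1` `[a, +oo[%classic); last first.
    by apply/seteqP; split => w /=; rewrite in_itv /= andbT.
  by apply: mL; exact: measurable_itv.
have FUC n : F n (~` U n).
  by case: (sF n) => _ h _; have := h _ (FU n); rewrite setTD.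
have NS n : N n.+1 = N n `&` ~` U n.+1.
  apply/seteqP; split=> w /= => [h|[h /negP]].
    by split=> [k kn|]; [apply: h; exact: leqW|apply/negP; rewrite -ltNge; exact: h].
  by rewrite -ltNge => h1 k; rewrite leq_eqVlt => /predU1P[->//|]; rewrite ltnS => /h.
have N0 : N 0%N = ~` U 0%N.
  apply/seteqP; split=> w /= => [h|/negP].
    by apply/negP; rewrite -ltNge; exact: h.
  by rewrite -ltNge => h1 k; rewrite leqn0 => /eqP ->.
have FI n A B : F n A -> F n B -> F n (A `&` B).
  move=> FA FB; apply: sub_sigma_algebraE => //.
  by apply: measurableI; rewrite /measurable /= sigma_algebra_id.
have FN n : F n (N n).
  elim: n => [|n IH]; first by rewrite N0.
  by rewrite NS; apply: FI => //; exact: Fi.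
have mU n : measurable (U n) by exact: (Fm n).
have mN n : measurable (N n) by exact: (Fm n).
have mL' n : measurable_fun setT (L n) by exact: measurable_wrt_le (Fm n) (mL n).
have mLA n A : measurable_fun A (EFin \o L n).
  by apply/measurable_EFinP; exact: measurable_funTS.
have hitU n A : measurable A -> A `<=` U n ->
    (a%:E * P A <= \int[P]_(w in A) (L n w)%:E)%E.
  move=> mA AU; rewrite -integral_cst //; apply: ge0_le_integral => //.
  - by move=> w _; rewrite lee_fin ltW.
  - exact: mLA.
have main n : (a%:E * P (~` N n) + \int[P]_(w in N n) (L n w)%:E <= 1)%E.
  elim: n => [|n IH].
    apply: le_trans L1; rewrite N0 setCK.
    rewrite -(setUv (U 0%N)) ge0_integral_setU //; first by rewrite leeD2r // hitU.
    - by apply: measurableC.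
    - exact: mLA.
    - by move=> w _; rewrite lee_fin.
    - by apply/disj_setPS => w [].
  apply: le_trans IH.
  (* The second set collects the paths that reach the level for the first time at [n.+1]; there
     [L n.+1] is at least [a]. *)
  have -> : ~` N n.+1 = ~` N n `|` (N n `&` U n.+1).
    by rewrite NS setCI setCK setUIr setUCl setTI.
  rewrite measureU //; last 3 first.
  - exact: measurableC.
  - exact: measurableI.
  - by apply/seteqP; split=> w // [h [/h]].
  rewrite muleDr ?ge0_adde_def ?inE // -addeA leeD2l //.
  apply: le_trans (Ls n _ (FN n)).
  have NE : N n = (N n `&` U n.+1) `|` N n.+1 by rewrite NS -setIUr setUv setIT.
  rewrite {2}NE ge0_integral_setU //.
  - by rewrite leeD2r // hitU //; exact: measurableI.
  - exact: measurableI.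
  - exact: mLA.
  - by move=> w _; rewrite lee_fin.
  - by rewrite NS; apply/disj_setPS => w [[_ h] [_ /(_ h)]].
have PN n : (P (~` N n) <= (a^-1)%:E)%E.
  rewrite -[leRHS]mule1 lee_pdivlMl //; apply: le_trans (main n).
  by rewrite leeDl // integral_ge0 // => w _; rewrite lee_fin.
have -> : \bigcup_n U n = \bigcup_n (~` N n).
  apply/seteqP; split=> w [n _] h.
    by exists n => // /(_ n (leqnn _)); rewrite ltNge h.
  apply: contrapT => hU; apply: h => k _; rewrite ltNge; apply/negP => h.
  by apply: hU; exists k.
have mC n : measurable (~` N n) by exact: measurableC.
have cv : P (~` N n) @[n --> \oo] --> P (\bigcup_n (~` N n)).
  apply: nondecreasing_cvg_mu => //; first exact: bigcup_measurable.
  move=> m n mn; apply/subsetPset => w /= h1 h2; apply: h1 => k km.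
  by apply: h2; exact: leq_trans mn.
rewrite -(cvg_lim _ cv) //; apply: lime_le; first by apply/cvg_ex; eexists; exact: cv.
exact: nearW.
Qed.

End SubSigmaAlgebra.

(** * An elementary bound on the exponential *)

Section ExpBound.
Context {R : realType}.

(** The difference [g] of the two sides vanishes at 0 and its derivative has the sign of [t]. For
    [t > 0] this follows from [expR t <= 1 / (1 - t)] and [(1 - t) (1 + (1 + eps) t) >= 1]; the
    latter is where the threshold [eps / (1 + eps)] comes from. *)
Lemma expR_le_quadratic (eps y : R) : 0 < eps -> `|y| <= eps / (1 + eps) ->
  expR y <= 1 + y + (1 + eps) / 2 * y ^+ 2.
Proof.
move=> e0 yd; set c := (1 + eps) / 2.
pose g (t : R) := 1 + t + c * t ^+ 2 - expR t.
have dg (t : R) : is_derive t 1 g (1 + 2 * c * t - expR t).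
  apply: is_derive_eq; rewrite /GRing.scale /=; ring.
have cg (a b : R) : {within `[a, b], continuous g}.
  by apply: derivable_within_continuous => t _; exact: ex_derive.
have g0 : g 0 = 0 by rewrite /g expR0; ring.
suff : 0 <= g y by rewrite /g subr_ge0.
have c2 : 2 * c = 1 + eps by rewrite /c; field.
have [y0|y0] := leP 0 y.
  rewrite ger0_norm // in yd.
  rewrite -g0; apply: (@ger0_derive1_le_cc R g 0 y) => //; last 2 first.
    by rewrite in_itv /= lexx.
    by rewrite in_itv /= lexx y0.
  move=> t; rewrite in_itv /= => /andP[t0 ty]; rewrite derive1E derive_val c2 subr_ge0.
  have tl : t * (1 + eps) < eps by rewrite -ltr_pdivlMr ?addr_gt0 // (lt_le_trans ty).
  have t1 : t < 1 by nra.
  have h := expR_ge1Dx (- t); have := expRxMexpNx_1 t.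
  have := expR_gt0 t; set u := expR t; set v := expR (- t) in h *.
  have : (1 - t) * (1 + (1 + eps) * t) >= 1 by nra.
  move=> h1 u0 uv; nra.
rewrite -g0; apply: (@ler0_derive1_le_cc R g y 0) => //; last 3 first.
- by rewrite in_itv /= lexx ltW.
- by rewrite in_itv /= lexx ltW.
- exact: ltW.
move=> t; rewrite in_itv /= => /andP[yt t0]; rewrite derive1E derive_val c2 subr_le0.
by apply: le_trans (expR_ge1Dx t); nra.
Qed.

End ExpBound.

(** * The exponential supermartingale attached to a fixed theta *)

Section ExponentialSupermartingale.
Context {R : realType} {disp : measure_display} {T : measurableType disp}.
Variable P : probability T R.

(** The set where one version exceeds the other lies in [G], and their difference integrates to 0
    over it. *)
Lemma is_condexp_ae_unique (G : set (set T)) (X Y Y' : T -> R) :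
  sigma_algebra setT G -> G `<=` measurable ->
  is_condexp P G X Y -> is_condexp P G X Y' -> {ae P, forall w, Y w = Y' w}.
Proof.
move=> sG Gm.
have le Z Z' : is_condexp P G X Z -> is_condexp P G X Z' -> {ae P, forall w, Z w <= Z' w}.
  move=> [_ mZ iZ XZ] [_ mZ' iZ' XZ'].
  pose h w := Z w - Z' w.
  pose A := [set w | 0 < h w].
  have mh : measurable_wrt G h.
    apply: measurable_wrtD => //.
    by apply: (measurable_wrt_comp (h := -%R)) => //; exact: oppr_measurable.
  have GA : G A.
    rewrite (_ : A = h @^-1` `]0, +oo[%classic); last first.
      by apply/seteqP; split => w /=; rewrite in_itv /= andbT.
    by apply: mh; exact: measurable_itv.
  have mA := Gm _ GA.
  have iA f : P.-integrable setT (EFin \o f) -> P.-integrable A (EFin \o f).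
    exact: integrableS measurableT mA (@subsetT _ _).
  have hA : (\int[P]_(w in A) `|(h w)%:E| = 0)%E.
    transitivity (\int[P]_(w in A) ((Z w)%:E - (Z' w)%:E))%E.
      apply: eq_integral => w; rewrite inE => Aw.
      by rewrite gee0_abs ?lee_fin ?ltW // EFinB.
    rewrite integralB_EFin //; [|exact: iA..].
    by rewrite XZ // -XZ' // subee //; exact: (integrable_fin_num mA (iA _ iZ')).
  have mhA : measurable_fun A (EFin \o h).
    by apply/measurable_EFinP; apply: measurable_funTS; exact: measurable_wrt_le Gm mh.
  have /(ae_eq_integral_abs P mA mhA) := hA.
  apply: filterS => w hw; rewrite leNgt; apply/negP => lt.
  have Aw : A w by rewrite /A /= /h subr_gt0.
  by have [hw0] := hw Aw; move: Aw; rewrite /A /= hw0 ltxx.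
move=> XY XY'; have h1 := le _ _ XY XY'; have h2 := le _ _ XY' XY.
by apply: filterS2 h1 h2 => w a b; apply/eqP; rewrite eq_le a b.
Qed.

Section Process.
Variables (d : nat) (F : nat -> set (set T)) (M : nat -> T -> 'cV[R]_d).
Variables (C V : nat -> T -> 'M[R]_d).
Hypothesis M_martingale : martingale P F M.
Hypothesis M_0 : {ae P, forall w, M 0%N w = 0}.
Hypothesis X_centered : forall n, (1 <= n)%N ->
       is_condexp_mx P (F n.-1) (increment M n) (fun=> 0).
Hypothesis X_bounded : forall n, (1 <= n)%N ->
       {ae P, forall w, enorm (increment M n w) <= 1}.
Hypothesis C_condexp : forall n, (1 <= n)%N ->
       is_condexp_mx P (F n.-1)
         (fun w => increment M n w *m (increment M n w)^T) (C n).
Hypothesis V_def : forall n w, V n w = \sum_(1 <= i < n.+1) C i w.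

Let filtF : filtration F. Proof. by case: M_martingale. Qed.
Let sF n : sigma_algebra setT (F n). Proof. by case: filtF. Qed.
Let Fm n : F n `<=` measurable. Proof. by case: filtF. Qed.
Let Fi n : F n `<=` F n.+1. Proof. by case: filtF. Qed.

Lemma quadratic_variation0 w : V 0%N w = 0.
Proof. by rewrite V_def big_geq. Qed.

Lemma quadratic_variationS n w : V n.+1 w = V n w + C n.+1 w.
Proof. by rewrite !V_def big_nat_recr. Qed.

(** [C n] is an arbitrary version, so symmetry is only almost sure: its entries [i j] and [j i] are
    versions of the same conditional expectation. *)
Lemma quadratic_variation_sym : {ae P, forall w, forall n, (V n w)^T = V n w}.
Proof.
have symC n i j : {ae P, forall w, C n.+1 w i j = C n.+1 w j i}.
  apply: (is_condexp_ae_unique (sF n) (@Fm n) (C_condexp (ltn0Sn n) i j)).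
  rewrite (_ : (fun w => _) = fun w => (increment M n.+1 w *m (increment M n.+1 w)^T) j i).
    exact: (C_condexp (ltn0Sn n) j i).
  by apply/funext => w; rewrite !mxE; apply: eq_bigr => k _; rewrite !mxE mulrC.
have : {ae P, forall w, forall n (i j : 'I_d), C n.+1 w i j = C n.+1 w j i}.
  apply: ae_foralln => n; apply: filter_forall => i; apply: filter_forall => j.
  exact: symC.
apply: filterS => w hC; elim=> [|n IH]; first by rewrite quadratic_variation0 trmx0.
rewrite quadratic_variationS linearD /= IH; congr (_ + _).
by apply/matrixP => i j; rewrite mxE hC.
Qed.

Definition exp_process (c : R) (theta : 'cV[R]_d) (n : nat) (w : T) : R :=
  expR (\sum_i theta i ord0 * M n w i ord0 - c * bform (V n w) theta theta).

Let mM (theta : 'cV[R]_d) n : measurable_wrt (F n) (fun w => \sum_i theta i ord0 * M n w i ord0).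
Proof.
apply: measurable_wrt_sum => // i; apply: measurable_wrtM => //.
  exact: measurable_wrt_cst.
by case: M_martingale.
Qed.

Let mCq theta n : measurable_wrt (F n) (fun w => bform (C n.+1 w) theta theta).
Proof.
under eq_fun do rewrite bformE.
apply: measurable_wrt_sum => // i; apply: measurable_wrt_sum => // j.
apply: measurable_wrtM => //; last exact: measurable_wrt_cst.
  apply: measurable_wrtM => //; first exact: measurable_wrt_cst.
  by case: (C_condexp (ltn0Sn n) i j).
Qed.

Let mVq theta n : measurable_wrt (F n) (fun w => bform (V n w) theta theta).
Proof.
elim: n => [|n IH].
  under eq_fun do rewrite quadratic_variation0 /bform mulmx0 mul0mx mxE.
  exact: measurable_wrt_cst.
under eq_fun do rewrite quadratic_variationS bformDm.
by apply: measurable_wrtD => //; apply: measurable_wrt_mono (@Fi n) _.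
Qed.

Lemma exp_process_measurable c theta n : measurable_wrt (F n) (exp_process c theta n).
Proof.
apply: (measurable_wrt_comp (h := expR)) => //.
apply: measurable_wrtD => //.
apply: (measurable_wrt_comp (h := -%R)); first exact: oppr_measurable.
by apply: measurable_wrtM => //; exact: measurable_wrt_cst.
Qed.

Lemma exp_process_supermartingale eps theta n A : 0 < eps ->
  enorm theta <= eps / (1 + eps) -> F n A ->
  (\int[P]_(w in A) (exp_process ((1 + eps) / 2) theta n.+1 w)%:E <=
   \int[P]_(w in A) (exp_process ((1 + eps) / 2) theta n w)%:E)%E.
Proof.
move=> e0 thd FA; set c := (1 + eps) / 2.
pose X w := \sum_i theta i ord0 * increment M n.+1 w i ord0.
pose q w := bform (C n.+1 w) theta theta.
(* [Z] is the part of the process at time [n.+1] that is known at time [n], restricted to [A]: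
   [V n.+1] is predictable. Multiplying it by [expR (X w)] or [expR (c * q w)] gives the process on
   [A] at time [n.+1] or [n]. *)
pose Z w := \1_A w * expR (\sum_i theta i ord0 * M n w i ord0
  - c * bform (V n.+1 w) theta theta).
have cX : is_condexp P (F n) X (fun=> 0).
  have := is_condexp_sum (index_enum 'I_d) (fun i => theta i ord0) (sF n) (@Fm n)
     (fun i => X_centered (ltn0Sn n) i ord0).
  congr (is_condexp P _ _ _); apply/funext => w.
  by rewrite big1 // => i _; rewrite mxE mulr0.
have cX2 : is_condexp P (F n) (fun w => X w ^+ 2) q.
  have := is_condexp_sum (index_enum 'I_d) (fun i => theta i ord0) (sF n) (@Fm n)
    (fun i => is_condexp_sum (index_enum 'I_d) (fun j => theta j ord0) (sF n) (@Fm n)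
     (fun j => C_condexp (ltn0Sn n) i j)).
  congr (is_condexp P _ _ _); apply/funext => w.
    rewrite /X expr2 mulr_suml; apply: eq_bigr => i _; rewrite -mulrA; congr (_ * _).
    rewrite mulr_sumr; apply: eq_bigr => j _.
    by rewrite [(_ *m _) _ _]mxE big_ord1 [_^T _ _]mxE; ring.
  rewrite /q bformE; apply: eq_bigr => i _; rewrite mulr_sumr.
  by apply: eq_bigr => j _; ring.
have Xd : {ae P, forall w, `|X w| <= eps / (1 + eps)}.
  apply: filterS (X_bounded (ltn0Sn n)) => w hw.
  apply: le_trans (enorm_CauchySchwarz _ _) _; rewrite -[leRHS]mulr1.
  by rewrite ler_pM ?enorm_ge0.
have Z0 w : 0 <= Z w by rewrite mulr_ge0 ?expR_ge0 // indicE.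
have mZ : measurable_wrt (F n) Z.
  apply: measurable_wrtM => //.
    apply/measurable_wrtP => //; apply: measurable_indic.
    by rewrite /measurable /= sigma_algebra_id.
  apply: (measurable_wrt_comp (h := expR)) => //.
  apply: measurable_wrtD => //.
  apply: (measurable_wrt_comp (h := -%R)); first exact: oppr_measurable.
  apply: measurable_wrtM => //; first exact: measurable_wrt_cst.
  under eq_fun do rewrite quadratic_variationS bformDm.
  exact: measurable_wrtD.
have c4 : 1 <= 4 * c by rewrite /c; lra.
have := expR_condexp_le (sF n) (@Fm n) cX cX2 Xd
  (fun y => expR_le_quadratic e0) c4 Z0 mZ.
have EA (f : T -> R) : (\int[P]_(w in A) (f w)%:E = \int[P]_w (\1_A w * f w)%:E)%E.
  rewrite integral_mkcond epatch_indic; apply: eq_integral => w _.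
  by rewrite muleC.
have E1 : (fun w => (Z w * expR (X w))%:E) =
    fun w => (\1_A w * exp_process c theta n.+1 w)%:E.
  apply/funext => w; rewrite /Z -[in LHS]mulrA -expRD /exp_process.
  congr (_ * expR _)%:E; rewrite addrAC; congr (_ - _).
  rewrite -big_split; apply: eq_bigr => i _ /=.
  by rewrite -mulrDr; congr (_ * _); rewrite /increment /= !mxE subrKC.
have E2 : (fun w => (Z w * expR (c * q w))%:E) =
    fun w => (\1_A w * exp_process c theta n w)%:E.
  apply/funext => w; rewrite /Z -[in LHS](mulrA (\1_A w)) -expRD /exp_process.
  by congr (_ * expR _)%:E; rewrite quadratic_variationS bformDm /q; ring.
by rewrite !EA E1 E2.
Qed.

Lemma exp_process_ville eps theta a : 0 < eps -> enorm theta <= eps / (1 + eps) ->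
  0 < a ->
  (P (\bigcup_n [set w | (a <= exp_process ((1 + eps) / 2) theta n w)%R]) <= (a^-1)%:E)%E.
Proof.
move=> e0 thd a0; set c := (1 + eps) / 2.
have Lm n : measurable_wrt (F n) (exp_process c theta n) by exact: exp_process_measurable.
have L0 n w : 0 <= exp_process c theta n w by exact: expR_ge0.
have L1 : (\int[P]_w (exp_process c theta 0%N w)%:E <= 1)%E.
  have <- : (\int[P]_w cst 1%:E w = 1)%E.
    rewrite integral_cst // mul1e; exact: probability_setT.
  apply: ae_ge0_le_integral => //.
  - by move=> w _; rewrite lee_fin L0.
  - apply/measurable_EFinP; exact: (measurable_wrt_le (@Fm 0%N) (Lm 0%N)).
  apply: filterS M_0 => w M0 _; rewrite /exp_process M0 quadratic_variation0.
  rewrite /bform mulmx0 mul0mx mxE mulr0 subr0 big1 ?expR0 // => i _.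
  by rewrite mxE mulr0.
have Ls n A := @exp_process_supermartingale eps theta n A e0 thd.
exact: (ville_inequality filtF Lm L0 Ls L1 a0).
Qed.

End Process.
End ExponentialSupermartingale.

(** * The weighted grid *)

Section Weights.
Context {R : realType}.
Variable eps : R.
Hypothesis eps_gt0 : 0 < eps.

(** The increments of [n^(-eps)]: the sum telescopes to at most 1, while each term is still of order
    [n^(-1-eps)]. *)
Definition polyweight (n : nat) : R :=
  expR (- eps * ln n.+1%:R) - expR (- eps * ln n.+2%:R).

(** The geometric distribution of ratio [2^(-eps)]. *)
Definition geomweight (n : nat) : R :=
  expR (- eps * ln 2) ^+ n * (1 - expR (- eps * ln 2)).

(* For coordinates of theta of order r, the numerator z is of order 2^j, so that
   [polyweight z] already costs (1 + eps) j ln 2; the geometric factor, of cost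
   eps j ln 2, makes the sum over j converge, and 1/2 accounts for the sign. *)
Definition dyadic_weight (g : nat * nat * bool) : R :=
  geomweight g.1.1 * polyweight g.1.2 / 2.

(** As [k] is of order [log lam], the factor [polyweight k] accounts for the [log log lam] term. *)
Definition grid_weight d (k : nat) (g : 'I_d -> nat * nat * bool) : R :=
  polyweight k * \prod_i dyadic_weight (g i).

(* With x = n + 2: (1 - 1/x)^(-eps) >= 1 - eps ln (1 - 1/x) >= 1 + eps / x. *)
Lemma polyweight_ge n : eps * expR (- (1 + eps) * ln n.+2%:R) <= polyweight n.
Proof.
set x : R := n.+2%:R; have x0 : 0 < x by rewrite ltr0n.
have x1 : n.+1%:R = x * (1 + - x^-1).
  by rewrite mulrDr mulrN mulfV ?gt_eqF // mulr1 /x -[n.+2%:R]natr1 addrK.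
have xV : x^-1 < 1 by rewrite invf_lt1 // ltr1n.
have l1 : ln n.+1%:R = ln x + ln (1 + - x^-1).
  by rewrite x1 lnM // posrE subr_gt0.
have l2 : ln (1 + - x^-1) <= - x^-1 by apply: le_ln1Dx; rewrite ltrN2.
rewrite /polyweight -/x l1 mulrDr expRD.
have -> : - (1 + eps) * ln x = - eps * ln x + - ln x by ring.
rewrite expRD expRN lnK ?posrE // mulrCA -[X in _ - X]mulr1 -mulrBr.
rewrite ler_wpM2l ?expR_ge0 // lerBrDr addrC.
apply: le_trans (expR_ge1Dx _); rewrite lerD2l.
by rewrite mulNr -mulrN ler_wpM2l ?(ltW eps_gt0) // lerNr.
Qed.

Lemma polyweight_gt0 n : 0 < polyweight n.
Proof. by apply: lt_le_trans (polyweight_ge n); rewrite mulr_gt0 // expR_gt0. Qed.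

Lemma expR_eps_ln2_lt1 : expR (- eps * ln 2) < 1.
Proof. by rewrite expR_lt1 mulNr oppr_lt0 mulr_gt0 // ln_gt0 // ltr1n. Qed.

Lemma geomweight_gt0 n : 0 < geomweight n.
Proof. by rewrite mulr_gt0 ?exprn_gt0 ?expR_gt0 // subr_gt0 expR_eps_ln2_lt1. Qed.

Lemma dyadic_weight_gt0 g : 0 < dyadic_weight g.
Proof. by rewrite divr_gt0 // mulr_gt0 ?geomweight_gt0 ?polyweight_gt0. Qed.

Lemma grid_weight_gt0 d k (g : 'I_d -> _) : 0 < grid_weight k g.
Proof. by rewrite mulr_gt0 ?polyweight_gt0 ?prodr_gt0 // => i _; exact: dyadic_weight_gt0. Qed.

Lemma sum_polyweight N : \sum_(i < N) polyweight i <= 1.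
Proof.
pose f n : R := - expR (- eps * ln n.+1%:R).
rewrite -(big_mkord xpredT) (eq_bigr (fun i => f i.+1 - f i)); last first.
  by move=> i _; rewrite /f opprK addrC.
rewrite telescope_sumr // /f ln1 mulr0 expR0 opprK gerDr oppr_le0.
exact: expR_ge0.
Qed.

Lemma sum_geomweight N : \sum_(i < N) geomweight i <= 1.
Proof.
set x := expR (- eps * ln 2); pose f n : R := - x ^+ n.
rewrite -(big_mkord xpredT) (eq_bigr (fun i => f i.+1 - f i)); last first.
  by move=> i _; rewrite /f /geomweight -/x exprS; ring.
by rewrite telescope_sumr // /f expr0 opprK gerDr oppr_le0 exprn_ge0 // expR_ge0.
Qed.

(** Expanding a product of sums over coordinates identifies the inner sum with [polyweight k] times
    the [d]-th power of a one-coordinate total, which is at most 1. *)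
Lemma sum_grid_weight d N :
  \sum_(k < N) \sum_(g : {ffun 'I_d -> 'I_N * 'I_N * bool})
     grid_weight k (fun i => (val (g i).1.1, val (g i).1.2, (g i).2)) <= 1.
Proof.
have pge n : 0 <= polyweight n by rewrite ltW // polyweight_gt0.
have gge n : 0 <= geomweight n by rewrite ltW // geomweight_gt0.
have dsum : 0 <= \sum_(t : 'I_N * 'I_N * bool)
    dyadic_weight (val t.1.1, val t.1.2, t.2) <= 1.
  rewrite -(pair_bigA _ (fun (u : 'I_N * 'I_N) b =>
    dyadic_weight (val u.1, val u.2, b))) /=.
  rewrite -(pair_bigA _ (fun (u v : 'I_N) => \sum_b
    dyadic_weight (val u, val v, b))) /=.
  have -> : \sum_(u < N) \sum_(v < N) \sum_b dyadic_weight (val u, val v, b) =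
      (\sum_(u < N) geomweight u) * (\sum_(v < N) polyweight v).
    rewrite mulr_suml; apply: eq_bigr => u _; rewrite mulr_sumr.
    apply: eq_bigr => v _; rewrite big_bool /dyadic_weight /=.
    by rewrite -splitr.
  by rewrite mulr_ge0 ?sumr_ge0 //= mulr_ile1 ?sumr_ge0 ?sum_geomweight ?sum_polyweight.
apply: le_trans (sum_polyweight N); apply: ler_sum => k _.
rewrite -mulr_sumr ler_piMr //.
rewrite -(bigA_distr_bigA (fun (_ : 'I_d) (t : 'I_N * 'I_N * bool) =>
   dyadic_weight (val t.1.1, val t.1.2, t.2))) prodr_const exprn_ile1 //; by case/andP: dsum.
Qed.

End Weights.

(** * Union bound over the grid *)

Section CountableMixture.
Context {R : realType} {disp : measure_display} {T : measurableType disp}.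
Variable P : probability T R.

Lemma measure_bigsetU_le (I : Type) (s : seq I) (A : I -> set T) :
  (forall i, measurable (A i)) ->
  (P (\big[setU/set0]_(i <- s) A i) <= \sum_(i <- s) P (A i))%E.
Proof.
move=> mA; suff [] : measurable (\big[setU/set0]_(i <- s) A i) /\
  (P (\big[setU/set0]_(i <- s) A i) <= \sum_(i <- s) P (A i))%E by [].
elim/big_rec2: _ => [|i y B _ [mB yB]]; first by rewrite measure0.
split; first exact: measurableU.
by apply: le_trans (measureU2 _ _ _) _ => //; rewrite leeD2l.
Qed.

(* Union bound: level [a = (m + 1) / weight] excludes all grid points at once
   outside an event of probability at most 1 / (m + 1). *)
Lemma ae_grid_bound d (eps : R)
    (E : R -> nat -> ('I_d -> nat * nat * bool) -> set T) : 0 < eps ->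
  (forall a k g, measurable (E a k g)) ->
  (forall a k g, 0 < a -> (P (E a k g) <= (a^-1)%:E)%E) ->
  {ae P, forall w, exists m : nat, forall k g, ~ E (m.+1%:R / grid_weight eps k g) k g w}.
Proof.
move=> e0 mE PE; pose W := @grid_weight R eps d.
have W0 k g : 0 < W k g by exact: grid_weight_gt0.
(* The grid is exhausted by finite boxes, so that finite subadditivity and continuity from below
   suffice. *)
pose small N (k : nat) (g : 'I_d -> nat * nat * bool) :=
  (k < N)%N /\ forall i, ((g i).1.1 < N)%N /\ ((g i).1.2 < N)%N.
pose B m N := [set w | exists k g, small N k g /\ E (m.+1%:R / W k g) k g w].
have BE m N : B m N = \big[setU/set0]_(k < N)
   \big[setU/set0]_(g : {ffun 'I_d -> 'I_N * 'I_N * bool})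
     (let g' i := (val (g i).1.1, val (g i).1.2, (g i).2) in E (m.+1%:R / W k g') k g').
  rewrite -bigcup_seq; under [RHS]eq_bigcupr do rewrite -bigcup_seq.
  apply/seteqP; split=> w.
    move=> [k [g [[kN gN] Ew]]]; exists (Ordinal kN); first by rewrite /= mem_index_enum.
    exists [ffun i => (Ordinal (proj1 (gN i)), Ordinal (proj2 (gN i)), (g i).2)].
      by rewrite /= mem_index_enum.
    rewrite /= (_ : (fun i => _) = g) //; apply/funext => i.
    by rewrite ffunE /=; case: (g i) => -[].
  move=> [k _ [g _ Ew]]; exists k, (fun i => (val (g i).1.1, val (g i).1.2, (g i).2)).
  by split=> //; split=> [|i]; [exact: ltn_ord|split; exact: ltn_ord].
have mB m N : measurable (B m N).
  rewrite BE; apply: bigsetU_measurable => k _; apply: bigsetU_measurable => g _; exact: mE.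
have PB m N : (P (B m N) <= (m.+1%:R^-1)%:E)%E.
  rewrite BE; apply: le_trans (measure_bigsetU_le _ _) _.
    by move=> k; apply: bigsetU_measurable => g _; exact: mE.
  apply: (@le_trans _ _ (\sum_(k < N) \sum_(g : {ffun 'I_d -> 'I_N * 'I_N * bool})
     (m.+1%:R^-1 * W k (fun i => (val (g i).1.1, val (g i).1.2, (g i).2)))%:E)%E).
    apply: lee_sum => k _; apply: le_trans (measure_bigsetU_le _ _) _ => [g|].
      exact: mE.
    apply: lee_sum => g _; apply: le_trans (PE _ _ _ _) _; first by rewrite divr_gt0.
    by rewrite invfM invrK.
  under eq_bigr do rewrite sumEFin -mulr_sumr.
  rewrite sumEFin -mulr_sumr lee_fin ler_piMr ?invr_ge0 //.
  exact: sum_grid_weight.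
have PU m : (P (\bigcup_N B m N) <= (m.+1%:R^-1)%:E)%E.
  have cv : P (B m n) @[n --> \oo] --> P (\bigcup_n B m n).
    apply: nondecreasing_cvg_mu => //; first exact: bigcup_measurable.
    move=> n n' nn'; apply/subsetPset => w [k [g [[kn gn] Ew]]].
    exists k, g; split => //; split=> [|i]; first exact: leq_trans nn'.
    by have [h1 h2] := gn i; split; exact: leq_trans nn'.
  rewrite -(cvg_lim _ cv) //; apply: lime_le; first by apply/cvg_ex; eexists; exact: cv.
  exact: nearW.
(* On this exceptional set every level [m] is violated by some grid point, so its probability is at
   most [1 / (m + 1)] for each [m]. *)
exists (\bigcap_m \bigcup_N B m N); split.
- apply: bigcap_measurable => // m _; exact: bigcup_measurable.
- apply/eqP; rewrite eq_le measure_ge0 andbT; apply/lee_addgt0Pr => e e_gt0.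
  rewrite add0e; pose m := Num.truncn e^-1.
  apply: (@le_trans _ _ (P (\bigcup_N B m N))).
    apply: le_measure; rewrite ?inE //.
    + by apply: bigcap_measurable => // n _; exact: bigcup_measurable.
    + exact: bigcup_measurable.
    + by apply: bigcap_inf.
  apply: le_trans (PU m) _; rewrite lee_fin invf_ple ?posrE //.
  by rewrite ltW // truncnS_gt.
- move=> w /= /forallNP nw m _; have /existsNP [k /existsNP [g /contrapT Ew]] := nw m.
  pose N := (k + \sum_i ((g i).1.1 + (g i).1.2)).+1.
  exists N => //; exists k, g; split => //; split; first by rewrite ltnS leq_addr.
  move=> i; rewrite /N (bigD1 i) //=; split; lia.
Qed.

End CountableMixture.

(** * Pathwise argument *)

Section Deterministic.
Context {R : realType}.
Local Notation qform A x := (bform A x x).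

Lemma ln_prod (I : Type) (s : seq I) (f : I -> R) : (forall i, 0 < f i) ->
  ln (\prod_(i <- s) f i) = \sum_(i <- s) ln (f i).
Proof.
move=> f0; elim: s => [|i s IH]; first by rewrite !big_nil ln1.
by rewrite !big_cons lnM ?posrE ?prodr_gt0 // IH.
Qed.

(** The cost of a grid point in the union bound; [K] absorbs the normalizations [eps],
    [1 - 2^(-eps)] and [1 / 2]. *)
Lemma ln_grid_weight (eps : R) d : 0 < eps ->
  exists K, forall k (g : 'I_d -> nat * nat * bool),
    - ln (grid_weight eps k g) <= K + (1 + eps) * ln k.+2%:R +
      \sum_i ((1 + eps) * ln (g i).1.2.+2%:R + eps * ln 2 * (g i).1.1%:R).
Proof.
move=> e0; set x := expR (- eps * ln 2).
have x1 : 0 < 1 - x by rewrite subr_gt0 expR_eps_ln2_lt1.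
have pE n : - ln (polyweight eps n) <= - ln eps + (1 + eps) * ln n.+2%:R.
  rewrite lerNl opprD opprK -mulNr.
  rewrite -[X in _ + X]expRK -lnM ?posrE ?expR_gt0 //.
  by rewrite ler_ln ?posrE ?mulr_gt0 ?expR_gt0 ?polyweight_gt0 // polyweight_ge.
pose K1 := - ln eps - ln (1 - x) + ln 2.
exists (- ln eps + d%:R * K1) => k g.
rewrite /grid_weight lnM ?posrE ?polyweight_gt0 //; last first.
  by rewrite prodr_gt0 // => i _; exact: dyadic_weight_gt0.
rewrite ln_prod; last by move=> i; exact: dyadic_weight_gt0.
have -> : d%:R * K1 = \sum_(i < d) K1 by rewrite sumr_const card_ord mulr_natl.
have h1 := pE k; set S2 := \sum_(i < d) (_ * ln _ + _).
suff h2 : - \sum_(i < d) ln (dyadic_weight eps (g i)) <= \sum_(i < d) K1 + S2.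
  by rewrite opprD; lra.
rewrite /S2 -sumrN -big_split; apply: ler_sum => i _ /=.
have gp := mulr_gt0 (geomweight_gt0 e0 (g i).1.1) (polyweight_gt0 e0 (g i).1.2).
rewrite /dyadic_weight lnM ?posrE ?invr_gt0 //.
rewrite lnM ?posrE ?geomweight_gt0 ?polyweight_gt0 // lnV ?posrE //.
have xp : 0 < x by exact: expR_gt0.
rewrite /geomweight -/x lnM ?posrE ?exprn_gt0 // lnXn // expRK.
have := pE (g i).1.2; rewrite /K1 -mulr_natr; lra.
Qed.

(** The right side is [m^T V^-1 m]; from here on no square root of [V] is handled. *)
Lemma enorm_invsqrtmx_le d (V : 'M[R]_d) (m : 'cV[R]_d) : (1 <= d)%N ->
  psdmx V -> V \in unitmx ->
  enorm (invsqrtmx V *m m) ^+ 2 <= qform V (invmx V *m m).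
Proof.
move=> d1 pV uV; have u0 := psdmx_qform_ge0 (invmx V *m m) pV.
rewrite /invsqrtmx /sqrtmx; case: xgetP => [S _ [[sS pS] SS]|_].
  have uS : S \in unitmx by move: uV; rewrite -SS unitmx_mul => /andP[].
  have -> : qform V (invmx V *m m) = (m^T *m invmx V *m m) ord0 ord0.
    by have [sV _] := pV; rewrite /bform trmx_mul trmx_inv sV -!mulmxA mulKVmx.
  have -> : invmx V = invmx S *m invmx S.
    have E : V *m (invmx S *m invmx S) = 1%:M by rewrite -SS mulmxA mulmxK // mulmxV.
    by rewrite -[RHS](mulKmx uV) E mulmx1.
  by rewrite -[enorm _ ^+ 2]mul1r -qform_scalar /bform mulmx1 trmx_mul trmx_inv sS !mulmxA.
(* This case is void, but excluding it would require the existence of the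
   square root; here [sqrtmx V] is 0 and so is its [invmx]. *)
suff -> : invmx (0 : 'M[R]_d) = 0.
  by rewrite mul0mx sqr_enorm big1 // => i _; rewrite mxE expr0n.
rewrite /invmx; case: ifP => //; rewrite unitmxE -(prednK d1) det0 unitr0 //.
Qed.

Lemma det_scaled_ge1 d (V : 'M[R]_d) lam : 0 < lam -> psdmx (V - lam%:M) ->
  1 <= \det (lam^-1 *: V).
Proof.
move=> l0 pV; rewrite detZ exprVn ler_pdivlMl ?exprn_gt0 // mulr1.
exact: det_ge.
Qed.

Lemma dyadic_scale (lam : R) : 1 <= lam ->
  exists k : nat, 4 ^+ k <= lam /\ lam < 4 ^+ k.+1.
Proof.
move=> l1; have exk : exists k : nat, lam < 4 ^+ k.+1.
  exists (Num.bound lam).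
  rewrite (lt_le_trans (archi_boundP (le_trans ler01 l1))) //.
  by rewrite -natrX ler_nat (leq_trans (leqnSn _)) // ltnW // ltn_expl.
have [k hk kmin] := ex_minnP exk; exists k; split => //.
case: k kmin {hk} => [|k kmin]; first by rewrite expr0.
by rewrite leNgt; apply/negP => /kmin; rewrite ltnn.
Qed.

Lemma norm_dyadic (r : R) g : 0 < r -> `|dyadic r g| = r / 2 ^+ g.1.1 * g.1.2%:R.
Proof.
by move=> r0; rewrite normrM normrMsign normr_nat ger0_norm // divr_ge0 ?ltW // exprn_gt0.
Qed.

(** The vector [u = V^-1 m] has [V]-norm [a >= B], and the grid hypothesis is tested at a grid point
    [theta] near [(B / a) *: u]. The linear term is then about [B ^+ 2], the quadratic one about
    [(1 + eps) / 2 * B ^+ 2], and the log-weight has to make up the rest. The last assumption on [B]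
    makes [theta] short enough. *)
Lemma grid_bound_deterministic (eps K : R) d : 0 < eps ->
  exists K', 0 <= K' /\
  forall (V : 'M[R]_d) (m : 'cV[R]_d) lam B,
  expR 1 <= lam -> psdmx (V - lam%:M) ->
  (forall k (g : 'I_d -> nat * nat * bool),
     let theta := gridpt (2 ^- k) g in
     enorm theta <= eps / (1 + eps) ->
     \sum_i theta i ord0 * m i ord0 - (1 + eps) / 2 * qform V theta <=
     K - ln (grid_weight eps k g)) ->
  Num.sqrt d%:R <= B -> B ^+ 2 <= qform V (invmx V *m m) ->
  (B + Num.sqrt d%:R) ^+ 2 <= (eps / (1 + eps)) ^+ 2 * lam ->
  (1 - eps) * B ^+ 2 <=
  (1 + 2 * eps) * (2 * ln (ln lam) + ln (\det (lam^-1 *: V))) + K' * (1 + B).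
Proof.
move=> e0; have [K0 hK0] := ln_grid_weight d e0.
set s := Num.sqrt d%:R; have s0 : 0 <= s by exact: sqrtr_ge0.
have s2 : s ^+ 2 = d%:R by rewrite sqr_sqrtr.
(* [K1] collects the costs independent of [B]: level, normalization, scale, denominators and
   numerators. [K2] is the coefficient of [B] in the cost of the numerators, and [K'] adds the error
   terms in [s]. *)
pose K1 := `|K| + `|K0| + (1 + eps) * ln 3 + (1 + 2 * eps) / 2 * (d%:R * ln 16) +
  d%:R * (1 + eps) * (s + 1).
pose K2 := d%:R * (1 + eps).
pose K' := 2 * (K1 + (1 + eps) / 2 * s ^+ 2) + 2 * (K2 + s + (1 + eps) * s).
have ln3 : 0 <= ln 3 :> R by rewrite ln_ge0 // ler1n.
have ln16 : 0 <= ln 16 :> R by rewrite ln_ge0 // ler1n.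
have e1 : 0 <= 1 + eps by lra.
have e2 : 0 <= 1 + 2 * eps by lra.
have K10 : 0 <= K1.
  by rewrite /K1; do ![done | lra | apply: addr_ge0 | apply: mulr_ge0].
have K20 : 0 <= K2 by rewrite mulr_ge0.
exists K'; split; first 
  by rewrite /K'; do ![done | exact: sqr_ge0 | lra | apply: addr_ge0 | apply: mulr_ge0].
move=> V m lam B lame pV H sB Bq Blam.
have lam1 : 1 < lam by apply: lt_le_trans lame; rewrite expR_gt1.
have lam0 : 0 < lam by exact: lt_trans lam1.
have sV := psdmx_sub_sym pV; have /(psdmx_subP _ sV) lV := pV.
have psV : psdmx V.
  split=> // x; apply: le_trans (lV x); by rewrite mulr_ge0 ?sqr_ge0 ?ltW.
have detV : 0 < \det V by apply: lt_le_trans (det_ge lam0 pV); rewrite exprn_gt0.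
have uV : V \in unitmx by rewrite unitmxE unitfE gt_eqF.
have [k [hk1 hk2]] := dyadic_scale (ltW lam1).
have [r rE] : exists r : R, r = 2 ^- k by eexists.
have r0 : 0 < r by rewrite rE invr_gt0 exprn_gt0.
have r2 : r ^+ 2 = 4 ^- k by rewrite rE exprVn exprAC expr2 -natrM.
have rl1 : 1 <= r ^+ 2 * lam by rewrite r2 ler_pdivlMl ?exprn_gt0 // mulr1.
have rl4 : r ^+ 2 * lam <= 4.
  by rewrite r2 ler_pdivrMl ?exprn_gt0 // -exprSr ltW.
have B0 : 0 <= B by exact: le_trans sB.
set u := invmx V *m m in Bq; pose a := Num.sqrt (qform V u).
have a2 : a ^+ 2 = qform V u by rewrite sqr_sqrtr // psdmx_qform_ge0.
have aB : B <= a by rewrite -ler_sqr ?nnegrE ?sqrtr_ge0 // a2.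
pose tstar := (B / a) *: u.
have [g [hg hdet]] := grid_approx lam0 pV r0 rl1 tstar.
set theta := gridpt r g in hg.
have [e eE] : exists e, e = theta - tstar by eexists.
have thE : theta = tstar + e by rewrite eE addrC subrK.
have sqrle (x y : R) : 0 <= y -> x ^+ 2 <= y ^+ 2 -> - y <= x <= y.
  by move=> y0 h; rewrite -ler_norml -ler_sqr ?nnegrE // real_normK ?num_real.
have a0 : 0 <= a by exact: sqrtr_ge0.
(* If [a = 0] then [B = 0] as well, because [0 <= B <= a]. *)
have ba : B / a * a = B.
  have [az|an] := eqVneq a 0; last by rewrite divfK.
  by rewrite az mulr0; apply/eqP; rewrite eq_le B0 -az aB.
have qe : qform V e <= s ^+ 2 by rewrite s2 eE.
have qe0 : 0 <= qform V e by exact: psdmx_qform_ge0.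
have qt : qform V tstar = B ^+ 2.
  by rewrite bformZl bformZr -a2 -[in RHS]ba; ring.
have /andP[_ te] : - (B * s) <= bform V tstar e <= B * s.
  apply: sqrle; first exact: mulr_ge0.
  apply: le_trans (psdmx_CauchySchwarz _ _ psV) _.
  by rewrite qt exprMn ler_wpM2l ?sqr_ge0.
have qtheta : qform V theta <= (B + s) ^+ 2.
  rewrite thE bformDl !bformDr qt (bformC e tstar sV) [leRHS]sqrrD -mulr_natr; lra.
have lin : \sum_i theta i ord0 * m i ord0 = bform V theta u.
  rewrite /bform -mulmxA mulKVmx // mxE; apply: eq_bigr => i _.
  by rewrite [(_^T) _ _]mxE.
(* Replacing [a] by [B] in the lower bound [(B - s) * a] uses [s <= B <= a]. *)
have linge : (B - s) * B <= \sum_i theta i ord0 * m i ord0.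
  rewrite lin thE bformDl bformZl -a2.
  have /andP[eu _] : - (s * a) <= bform V e u <= s * a.
    apply: sqrle; first exact: mulr_ge0.
    apply: le_trans (psdmx_CauchySchwarz _ _ psV) _.
    by rewrite -a2 exprMn ler_wpM2r ?sqr_ge0.
  have -> : B / a * a ^+ 2 = B * a by rewrite expr2 mulrA ba.
  have : (B - s) * B <= (B - s) * a by rewrite ler_wpM2l // subr_ge0.
  lra.
have lamth : lam * enorm theta ^+ 2 <= (B + s) ^+ 2 by apply: le_trans (lV _) qtheta.
have d0 : 0 <= eps / (1 + eps) by rewrite divr_ge0 // ltW.
have thd : enorm theta <= eps / (1 + eps).
  rewrite -ler_sqr ?nnegrE ?enorm_ge0 //.
  by rewrite -(ler_pM2l lam0) [leRHS]mulrC; exact: le_trans lamth Blam.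
(* Each coordinate is at most [(B + s) / sqrt lam <= r (B + s)], so the numerator is at most
   [2^j (B + s)]. The crude linear bound on the logarithm is good enough, since the main terms are
   quadratic in [B]. *)
have zle i : ln (g i).1.2.+2%:R <= (g i).1.1%:R * ln 2 + (B + s + 1).
  have thi : r * (g i).1.2%:R <= 2 ^+ (g i).1.1 * enorm theta.
    have := ler_coord_enorm theta i; rewrite mxE norm_dyadic //.
    by rewrite mulrAC ler_pdivrMr ?exprn_gt0 // mulrC [_ * enorm _]mulrC.
  have zB : (g i).1.2%:R <= 2 ^+ (g i).1.1 * (B + s).
    rewrite -(ler_pM2l r0); apply: le_trans thi _.
    rewrite mulrCA ler_wpM2l ?exprn_ge0 //.
    have Bs0 : 0 <= B + s by rewrite addr_ge0.
    rewrite -ler_sqr ?nnegrE ?enorm_ge0 ?mulr_ge0 ?(ltW r0) //.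
    rewrite -(ler_pM2l lam0); apply: le_trans lamth _.
    by rewrite exprMn mulrA ler_peMl ?sqr_ge0 // mulrC.
  have zB2 : (g i).1.2.+2%:R <= 2 ^+ (g i).1.1 * (B + s + 2).
    rewrite -addn2 natrD mulrDr lerD //.
    by rewrite ler_peMl // exprn_ege1 // ler1n.
  have Bs2 : 0 < B + s + 2 by rewrite ltr_wpDl // addr_ge0.
  rewrite -ler_ln ?posrE ?mulr_gt0 ?exprn_gt0 // in zB2; apply: le_trans zB2 _.
  rewrite lnM ?posrE ?exprn_gt0 // lnXn // mulr_natl lerD2l.
  have -> : B + s + 2 = 1 + (B + s + 1) by ring.
  by apply: le_ln1Dx; rewrite (lt_le_trans (ltrN10 R)) // !addr_ge0.
have ln2 : 1 / 2 <= ln 2 :> R.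
  have := @le_ln1Dx R (- 2^-1).
  have -> : 1 + - 2^-1 = 2^-1 :> R by field.
  rewrite lnV ?posrE // => h; have := h _; rewrite ltrN2 invf_lt1 // ltr1n => /(_ isT); lra.
have lnl1 : 1 <= ln lam by rewrite -[X in X <= _]expRK ler_ln ?posrE ?expR_gt0.
have ln4 : ln 4 = 2 * ln 2 :> R.
  by rewrite [in LHS](natrM R 2 2) lnM ?posrE // mulr_natl mulr2n.
(* From [4 ^+ k <= lam] and [ln 4 >= 1] follows [k <= ln lam], and [k + 2 <= 3 ln lam] because
   [ln lam >= 1]. *)
have kle : ln k.+2%:R <= ln (ln lam) + ln 3.
  have : k%:R <= ln lam.
    have : ln (4 ^+ k) <= ln lam by rewrite ler_ln ?posrE ?exprn_gt0.
    rewrite lnXn // ln4 -[_ *+ k]mulr_natl => h; apply: le_trans h.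
    by rewrite ler_peMr //; lra.
  move=> kl; rewrite -lnM ?posrE ?(lt_le_trans ltr01 lnl1) //.
  rewrite ler_ln ?posrE ?mulr_gt0 ?(lt_le_trans ltr01 lnl1) //.
  by rewrite -addn2 natrD; lra.
(* The product of the denominators is controlled by [(4 r^2)^d \det V = (4 r^2 lam)^d \det (V /
   lam)], and [r^2 lam <= 4]. *)
have jle : 2 * (ln 2 * \sum_i (g i).1.1%:R) <= d%:R * ln 16 + ln (\det (lam^-1 *: V)).
  have d1 := det_scaled_ge1 lam0 pV.
  have : (4 * r ^+ 2) ^+ d * \det V <= 16 ^+ d * \det (lam^-1 *: V).
    rewrite detZ exprVn.
    have -> : (4 * r ^+ 2) ^+ d * \det V =
        (4 * (r ^+ 2 * lam)) ^+ d * ((lam ^+ d)^-1 * \det V).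
      by rewrite !exprMn; field; rewrite expf_eq0 gt_eqF ?andbF.
    rewrite ler_wpM2r ?mulr_ge0 ?invr_ge0 ?exprn_ge0 ?(ltW lam0) ?(ltW detV) //.
    have p0 : 0 <= 4 * (r ^+ 2 * lam) by rewrite mulr_ge0 // (le_trans ler01 rl1).
    have p16 : 4 * (r ^+ 2 * lam) <= 16 by lra.
    by apply: lerXn2r => //; rewrite nnegrE.
  have pr0 : 0 < \prod_i 2 ^+ (g i).1.1 :> R.
    by rewrite prodr_gt0 // => i _; rewrite exprn_gt0.
  have det0 : 0 < \det (lam^-1 *: V) by exact: lt_le_trans d1.
  move=> hX.
  have : ln ((\prod_i 2 ^+ (g i).1.1) ^+ 2) <= ln (16 ^+ d * \det (lam^-1 *: V)).
    by rewrite ler_ln ?posrE ?mulr_gt0 ?exprn_gt0 // (le_trans hdet hX).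
  rewrite lnXn //.
  rewrite ln_prod; last by move=> i; rewrite exprn_gt0.
  rewrite lnM ?posrE ?exprn_gt0 // lnXn // !mulr_natl.
  congr (_ <= _); congr (_ *+ _); rewrite mulr_sumr; apply: eq_bigr => i _.
  by rewrite lnXn // mulr_natr.
(* The factor [1 + 2 * eps] adds the cost [(1 + eps) j ln 2] of the numerator and the cost
   [eps j ln 2] of the geometric weight. *)
have sumle : \sum_i ((1 + eps) * ln (g i).1.2.+2%:R + eps * ln 2 * (g i).1.1%:R) <=
    (1 + 2 * eps) * (ln 2 * \sum_i (g i).1.1%:R) + d%:R * ((1 + eps) * (B + s + 1)).
  have -> : d%:R * ((1 + eps) * (B + s + 1)) = \sum_(i < d) ((1 + eps) * (B + s + 1)).
    by rewrite sumr_const card_ord mulr_natl.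
  rewrite !mulr_sumr -big_split; apply: ler_sum => i _ /=.
  have : (1 + eps) * ln (g i).1.2.+2%:R <= (1 + eps) * ((g i).1.1%:R * ln 2 + (B + s + 1)).
    by rewrite ler_wpM2l.
  lra.
have := H k g; rewrite /= -rE -/theta => /(_ thd) HH; have hw := hK0 k g.
have lnln0 : 0 <= ln (ln lam) by rewrite ln_ge0.
have D0 : 0 <= ln (\det (lam^-1 *: V)) by rewrite ln_ge0 // det_scaled_ge1.
have KK := ler_norm K; have KK0 := ler_norm K0.
have qc : (1 + eps) / 2 * qform V theta <= (1 + eps) / 2 * (B + s) ^+ 2.
  by rewrite ler_wpM2l // divr_ge0.
have kc : (1 + eps) * ln k.+2%:R <= (1 + eps) * (ln (ln lam) + ln 3).
  by rewrite ler_wpM2l.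
have jc : (1 + 2 * eps) * (2 * (ln 2 * \sum_i (g i).1.1%:R)) <=
   (1 + 2 * eps) * (d%:R * ln 16 + ln (\det (lam^-1 *: V))).
  by rewrite ler_wpM2l.
have fin : (B - s) * B - (1 + eps) / 2 * (B + s) ^+ 2 <= K1 + K2 * B +
    (1 + 2 * eps) / 2 * (2 * ln (ln lam) + ln (\det (lam^-1 *: V))).
  have el : 0 <= eps * ln (ln lam) by rewrite mulr_ge0 // ltW.
  apply: le_trans (_ : `|K| + `|K0| + (1 + eps) * (ln (ln lam) + ln 3) +
     ((1 + 2 * eps) / 2 * (d%:R * ln 16 + ln (\det (lam^-1 *: V))) +
     d%:R * ((1 + eps) * (B + s + 1))) <= _); last by rewrite /K1 /K2; lra.
  lra.
have -> : (1 - eps) * B ^+ 2 = 2 * ((B - s) * B - (1 + eps) / 2 * (B + s) ^+ 2) +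
   2 * ((1 + eps) / 2 * s ^+ 2 + (s + (1 + eps) * s) * B) by field.
have K1B : 0 <= K1 * B by rewrite mulr_ge0.
have sB0 : 0 <= (1 + eps) / 2 * s ^+ 2 * B.
  by rewrite !mulr_ge0 ?sqr_ge0 ?invr_ge0.
have s30 : 0 <= K2 + s + (1 + eps) * s by rewrite !addr_ge0 ?mulr_ge0.
rewrite /K'; lra.
Qed.

End Deterministic.

(** * From the quadratic inequality to the limsup *)

Section Conclusion.
Context {R : realType}.

(** The coefficient [(1 - eta / 4) (1 + eta)^2] exceeds [1 + eta / 2] by at least [3 eta / 4],
    whereas [K (1 + B) <= 3 K D < (3 eta / 4) D^2]. *)
Lemma contra_quadratic (eta K B D : R) : 0 < eta <= 1 -> 0 <= K ->
  1 + 4 * K / eta <= D -> B = (1 + eta) * D ->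
  (1 - eta / 4) * B ^+ 2 <= (1 + 2 * (eta / 4)) * D ^+ 2 + K * (1 + B) -> False.
Proof.
move=> /andP[e0 e1] K0 hD ->.
have q0 : 0 <= 4 * K / eta by rewrite divr_ge0 ?(ltW e0) // mulr_ge0.
have D1 : 1 <= D by lra.
have Dp : 0 < D by lra.
have KD : 4 * K < eta * D.
  by rewrite [eta * _]mulrC -ltr_pdivrMr //; lra.
have h1 : 1 + 2 * (eta / 4) + 3 / 4 * eta <= (1 - eta / 4) * (1 + eta) ^+ 2 by nra.
have h2 : (1 + 2 * (eta / 4) + 3 / 4 * eta) * D ^+ 2 <=
    (1 - eta / 4) * (1 + eta) ^+ 2 * D ^+ 2 by rewrite ler_wpM2r ?sqr_ge0.
have h3 : 4 * K * D < eta * D * D by rewrite ltr_pM2r.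
have h4 : K * (1 + (1 + eta) * D) <= K * (3 * D).
  rewrite ler_wpM2l //; have : eta * D <= 1 * D by rewrite ler_wpM2r // ltW.
  lra.
rewrite exprMn mulrA => h5; move: h2 h3 h4 h5; rewrite !expr2; lra.
Qed.

(** A crude bound, used only to see that [ln (ln lam)] is negligible against [lam]. *)
Lemma lnln_le_sqrt (x : R) : expR 1 <= x -> ln (ln x) <= 2 * Num.sqrt x.
Proof.
move=> x1; have x0 : 0 < x by apply: lt_le_trans x1; rewrite expR_gt0.
have lx : 1 <= ln x by rewrite -[leLHS]expRK ler_ln ?posrE ?expR_gt0.
have lnlt (y : R) : 0 < y -> ln y <= y.
  move=> y0; have -> : y = 1 + (y - 1) by ring.
  by apply: le_trans (le_ln1Dx _) _; lra.
apply: le_trans (lnlt _ _) _; first by lra.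
have -> : ln x = 2 * ln (Num.sqrt x).
  by rewrite mulr_natl -lnXn ?sqrtr_gt0 // sqr_sqrtr // ltW.
by rewrite ler_wpM2l // lnlt // sqrtr_gt0.
Qed.

(** If the ratio exceeded [1 + eta], then [grid_bound_deterministic] with [eps = eta / 4] and
    [B = (1 + eta) * D], where [D] is the denominator, would contradict [contra_quadratic]. *)
Lemma ratio_eventually_le (d : nat) (eta K : R) (V : nat -> 'M[R]_d) (m : nat -> 'cV[R]_d) :
  (1 <= d)%N -> 0 < eta <= 1 ->
  (forall k (g : 'I_d -> nat * nat * bool),
     let theta := gridpt (2 ^- k) g in
     enorm theta <= (eta / 4) / (1 + eta / 4) -> forall n,
     \sum_i theta i ord0 * m n i ord0 - (1 + eta / 4) / 2 * bform (V n) theta theta <=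
     K - ln (grid_weight (eta / 4) k g)) ->
  (forall n, (V n)^T = V n) ->
  lambda_min (V n) @[n --> \oo] --> +oo ->
  (fun n => ln (\det ((lambda_min (V n))^-1 *: V n))) =o_\oo (fun n => lambda_min (V n)) ->
  \forall n \near \oo, enorm (invsqrtmx (V n) *m m n) /
         Num.sqrt (2 * ln (ln (lambda_min (V n)))
                   + ln (\det ((lambda_min (V n))^-1 *: V n))) <= 1 + eta.
Proof.
move=> d1 eta01 H sV lamoo odet; have /andP[eta0 eta1] := eta01.
set eps := eta / 4; have eps0 : 0 < eps by rewrite /eps; lra.
have [K' [K'0 grid]] := grid_bound_deterministic K d eps0.
pose s : R := Num.sqrt d%:R; have s0 : 0 <= s by exact: sqrtr_ge0.
set delta := eps / (1 + eps); have del0 : 0 < delta by rewrite divr_gt0 // addr_gt0.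
(* [D0] dominates both [s] and the threshold of [contra_quadratic]; taking [lam] beyond
   [expR (expR (D0 ^+ 2))] forces [D0 <= D]. *)
pose D0 := 1 + s + 4 * K' / eta.
have q0 : 0 <= 4 * K' / eta by rewrite divr_ge0 ?(ltW eta0) // mulr_ge0.
have big A : \forall n \near \oo, A <= lambda_min (V n) by move/cvgryPge: lamoo; exact.
(* Since [B <= 2 * D] and [s <= D], it suffices for shortness that [9 * D ^+ 2 <= delta ^+ 2 * lam].
   The constant 18 makes [9 * Delta] at most half of the right side; the threshold [72 / delta ^+ 2]
   for [sqrt lam] does the same for [18 * ln (ln lam)]. *)
have small : \forall n \near \oo, `|ln (\det ((lambda_min (V n))^-1 *: V n))| <=
    delta ^+ 2 / 18 * `|lambda_min (V n)|.
  by move/eqoP: odet => /(_ (delta ^+ 2 / 18)); apply; rewrite divr_gt0 // exprn_gt0.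
near=> n.
have lam_e : expR 1 <= lambda_min (V n) by near: n; exact: big.
have lam_D0 : expR (expR (D0 ^+ 2)) <= lambda_min (V n) by near: n; exact: big.
have lam_del : (72 / delta ^+ 2) ^+ 2 <= lambda_min (V n) by near: n; exact: big.
have Dsm : `|ln (\det ((lambda_min (V n))^-1 *: V n))| <=
    delta ^+ 2 / 18 * `|lambda_min (V n)| by near: n; exact: small.
set lam := lambda_min (V n) in lam_e lam_D0 lam_del Dsm *.
set Delta := ln (\det (lam^-1 *: V n)) in Dsm *.
have lam0 : 0 < lam by apply: lt_le_trans lam_e; rewrite expR_gt0.
have Dsmall : Delta <= delta ^+ 2 / 18 * lam.
  by move: Dsm; rewrite (gtr0_norm lam0); apply: le_trans; exact: ler_norm.
have pV := psdmx_sub_lambda_min d1 (sV n); rewrite -/lam in pV.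
have Delta0 : 0 <= Delta by rewrite ln_ge0 // det_scaled_ge1.
have lnln : D0 ^+ 2 <= ln (ln lam).
  rewrite -[leLHS]expRK ler_ln ?posrE ?expR_gt0 //; last first.
    by rewrite ln_gt0 // (lt_le_trans _ lam_e) // expR_gt1.
  by rewrite -[leLHS]expRK ler_ln ?posrE ?expR_gt0.
set D := Num.sqrt (2 * ln (ln lam) + Delta).
have D00 : 0 <= D0 by rewrite /D0; lra.
have D2 : D ^+ 2 = 2 * ln (ln lam) + Delta.
  by rewrite sqr_sqrtr // addr_ge0 // mulr_ge0 // (le_trans _ lnln) // sqr_ge0.
have DD0 : D0 <= D.
  rewrite -ler_sqr ?nnegrE ?sqrtr_ge0 // D2.
  have := sqr_ge0 D0; lra.
have Dp : 0 < D by apply: lt_le_trans DD0; rewrite /D0; lra.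
rewrite ler_pdivrMr // leNgt; apply/negP => ltE.
pose B := (1 + eta) * D.
have sD : s <= D by apply: le_trans DD0; rewrite /D0; lra.
have DB : D <= B by rewrite /B ler_peMl ?(ltW Dp) //; lra.
have B2D : B <= 2 * D by rewrite /B ler_wpM2r ?(ltW Dp) //; lra.
have B0 : 0 <= B by lra.
apply: (@contra_quadratic eta K' B D) => //; first by apply: le_trans DD0; rewrite /D0; lra.
rewrite -/eps D2; apply: (grid (V n) (m n) lam B) => //.
- by move=> k g theta th; exact: H.
- exact: le_trans DB.
- apply: (@le_trans _ _ (enorm (invsqrtmx (V n) *m m n) ^+ 2)).
    by rewrite ler_sqr ?nnegrE ?enorm_ge0 // ltW.
  apply: enorm_invsqrtmx_le => //.
    split=> // x; have /(psdmx_subP _ (sV n)) lV := pV.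
    by apply: le_trans (lV x); rewrite mulr_ge0 ?sqr_ge0 ?ltW.
  rewrite unitmxE unitfE gt_eqF // (lt_le_trans _ (det_ge lam0 pV)) //.
  by rewrite exprn_gt0.
- apply: (@le_trans _ _ (9 * D ^+ 2)).
    have -> : 9 * D ^+ 2 = (3 * D) ^+ 2 by ring.
    by rewrite -/s ler_sqr ?nnegrE ?mulr_ge0 ?addr_ge0 ?(ltW Dp) //; lra.
  rewrite D2; have := lnln_le_sqrt lam_e.
  have : 72 / delta ^+ 2 <= Num.sqrt lam.
    by rewrite -[leLHS]ger0_norm -?sqrtr_sqr ?ler_wsqrtr // divr_ge0 // sqr_ge0.
  rewrite ler_pdivrMr ?exprn_gt0 // => h1 h2.
  have : 72 * Num.sqrt lam <= Num.sqrt lam * delta ^+ 2 * Num.sqrt lam.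
    by rewrite ler_wpM2r ?sqrtr_ge0.
  have -> : Num.sqrt lam * delta ^+ 2 * Num.sqrt lam = delta ^+ 2 * lam.
    by rewrite mulrAC -expr2 sqr_sqrtr ?(ltW lam0) // mulrC.
  rewrite -/delta; move: Dsmall h2; rewrite mulrAC.
  move: (delta ^+ 2 * lam) (Num.sqrt lam) (ln (ln lam)) => t q l; lra.
Unshelve. all: by end_near.
Qed.

Lemma limn_esup_le (u : (\bar R)^nat) (l : \bar R) :
  (\forall n \near \oo, (u n <= l)%E) -> (limn_esup u <= l)%E.
Proof.
move=> [N _ hN]; rewrite limn_esup_lim; apply: lime_le; first exact: is_cvg_esups.
exists N => // n /= Nn; apply: ge_ereal_sup => _ [k /= nk <-].
by apply: hN => /=; exact: leq_trans nk.
Qed.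

End Conclusion.

Theorem mainTheorem7 (R : realType) (disp : measure_display)
    (T : measurableType disp) (P : probability T R)
    (d : nat) (d_ge1 : (1 <= d)%N)
    (F : nat -> set (set T)) (M : nat -> T -> 'cV[R]_d)
    (M_martingale : martingale P F M)
    (M_0 : {ae P, forall w, M 0%N w = 0})
    (X_centered : forall n, (1 <= n)%N ->
       is_condexp_mx P (F n.-1) (increment M n) (fun=> 0))
    (X_bounded : forall n, (1 <= n)%N ->
       {ae P, forall w, enorm (increment M n w) <= 1})
    (C : nat -> T -> 'M[R]_d)
    (C_condexp : forall n, (1 <= n)%N ->
       is_condexp_mx P (F n.-1)
         (fun w => increment M n w *m (increment M n w)^T) (C n))
    (V : nat -> T -> 'M[R]_d)
    (V_def : forall n w, V n w = \sum_(1 <= i < n.+1) C i w) :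
  {ae P, forall w,
     lambda_min (V n w) @[n --> \oo] --> +oo ->
     (fun n => ln (\det ((lambda_min (V n w))^-1 *: V n w)))
       =o_\oo (fun n => lambda_min (V n w)) ->
     (limn_esup (fun n =>
        (enorm (invsqrtmx (V n w) *m M n w) /
         Num.sqrt (2 * ln (ln (lambda_min (V n w)))
                   + ln (\det ((lambda_min (V n w))^-1 *: V n w))))%:E)
      <= 1)%E}.
Proof.
(* Countably many margins suffice, so the exceptional null sets can be united before a path is
   fixed. *)
pose eta N : R := N.+1%:R^-1.
have eta01 N : 0 < eta N <= 1 by rewrite invr_gt0 ltr0n /= invf_le1 ?ler1n ?ltr0n.
(* Codes of vectors too long for the exponential bound get the empty event, so that the union bound
   can run over the whole grid. *)
pose E N (a : R) k (g : 'I_d -> nat * nat * bool) :=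
  if enorm (gridpt (2 ^- k) g : 'cV[R]_d) <= (eta N / 4) / (1 + eta N / 4) then
    \bigcup_n [set w | a <= exp_process M V ((1 + eta N / 4) / 2) (gridpt (2 ^- k) g) n w]
  else set0.
have bound N : {ae P, forall w, exists p : nat, forall k g,
    ~ E N (p.+1%:R / grid_weight (eta N / 4) k g) k g w}.
  have /andP[e0 _] := eta01 N.
  apply: ae_grid_bound; first by rewrite divr_gt0.
    move=> a k g; rewrite /E; case: ifP => // _.
    apply: bigcup_measurable => n _.
    have [[_ Fm _] _ _ _] := M_martingale; apply: (Fm n).
    have mL := exp_process_measurable M_martingale C_condexp V_def
       ((1 + eta N / 4) / 2) (gridpt (2 ^- k) g) n.
    rewrite (_ : [set w | _] = exp_process M V ((1 + eta N / 4) / 2)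
      (gridpt (2 ^- k) g) n @^-1` `[a, +oo[%classic); last first.
      by apply/seteqP; split => w /=; rewrite in_itv /= andbT.
    by apply: mL; exact: measurable_itv.
  move=> a k g a0; rewrite /E; case: ifP => [hth|_]; last first.
    by rewrite measure0 lee_fin invr_ge0 ltW.
  apply: (exp_process_ville M_martingale M_0 X_centered X_bounded C_condexp V_def) => //.
  by rewrite divr_gt0.
have all_bound := ae_foralln bound.
have sym := quadratic_variation_sym M_martingale C_condexp V_def.
apply: filterS2 all_bound sym => w hb hs lamoo odet.
(* It is enough to bound the limsup by [1 + e] for every [e > 0]; [N] is then chosen with
   [eta N <= e]. *)
apply/lee_addgt0Pr => e e0.
pose N := Num.truncn e^-1.
have etae : eta N <= e by rewrite /eta invf_ple ?posrE // ltW // truncnS_gt.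
apply: limn_esup_le.
have [p hp] := hb N; have /andP[n0 _] := eta01 N.
have key k (g : 'I_d -> nat * nat * bool) : let theta := gridpt (2 ^- k) g : 'cV[R]_d in
    enorm theta <= (eta N / 4) / (1 + eta N / 4) -> forall n,
    \sum_i theta i ord0 * M n w i ord0 - (1 + eta N / 4) / 2 * bform (V n w) theta theta <=
    ln p.+1%:R - ln (grid_weight (eta N / 4) k g).
  move=> theta th n; have := hp k g; rewrite /E th => hnot.
  have W0 : 0 < grid_weight (eta N / 4) k g by apply: grid_weight_gt0; rewrite divr_gt0.
  have : exp_process M V ((1 + eta N / 4) / 2) theta n w <=
      p.+1%:R / grid_weight (eta N / 4) k g.
    by rewrite leNgt; apply/negP => /ltW h; apply: hnot; exists n.
  rewrite -ler_ln ?posrE ?expR_gt0 ?divr_gt0 ?ltr0n // expRK.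
  by rewrite lnM ?posrE ?invr_gt0 ?ltr0n // lnV.
have := ratio_eventually_le d_ge1 (eta01 N) key hs lamoo odet.
apply: filterS => n hn; rewrite -EFinD lee_fin; apply: le_trans hn _.
by rewrite lerD2l.
Qed.
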